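(* Let $d$ be a nonzero real number. Let $\Phi=\{\varphi^1,\dots,\varphi^r\}$ and $\Psi=\{\psi^1,\dots,\psi^s\}$ be subsets of $L_2(\mathbb R)$. Suppose that $\frac1{\sqrt{2\pi}}FWS_J(\Phi;\Psi)$ is an orthonormal basis of $L_2(\mathbb R)$ for some integer $J$ (this is equivalent to saying that $$\sum_{\ell=1}^r\sum_{k\in\mathbb Z}|\langle f,\varphi^\ell_{d^{-J};0,k}\rangle|^2+\sum_{j=J}^\infty\sum_{\ell=1}^s\sum_{k\in\mathbb Z}|\langle f,\psi^\ell_{d^{-j};0,k}\rangle|^2=2\pi\|f\|_{L_2(\mathbb R)}^2\qquad\forall f\in L_2(\mathbb R)$$ holds together with $\|\varphi^1\|_{L_2(\mathbb R)}=\dots=\|\varphi^r\|_{L_2(\mathbb R)}=\|\psi^1\|_{L_2(\mathbb R)}=\dots=\|\psi^s\|_{L_2(\mathbb R)}=\sqrt{2\pi}$). Denote $\vec\varphi:=(\varphi^1,\dots,\varphi^r)^T$ and $\vec\psi:=(\psi^1,\dots,\psi^s)^T$. Then there must exist an $r\times r$ matrix $a$ and an $s\times r$ matrix $b$ of $2\pi$-periodic measurable functions in $L_2(\mathbb T)$ such that $$\vec\varphi(d\xi)=a(\xi)\vec\varphi(\xi)\quad\text{and}\quad\vec\psi(d\xi)=b(\xi)\vec\varphi(\xi),\qquad\text{a.e. }\xi\in\mathbb R.$$ Moreover, if $|d|>1$, then $\frac1{\sqrt{2\pi}}FWS(\Psi)$ is also an orthonormal basis of $L_2(\mathbb R)$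.
   Context: $\langle f,g\rangle=\int_{\mathbb R}f\overline g$. $L_2(\mathbb T)$ is the space of $2\pi$-periodic measurable functions $h$ with $\int_{-\pi}^\pi|h|^2<\infty$. For $\lambda\ne0$, $f_{\lambda;0,k}(\xi):=|\lambda|^{1/2}e^{-ik\lambda\xi}f(\lambda\xi)$. For an integer $J$, $$FWS_J(\Phi;\Psi):=\{\varphi_{d^{-J};0,k}:k\in\mathbb Z,\varphi\in\Phi\}\cup\{\psi_{d^{-j};0,k}:j\ge J,k\in\mathbb Z,\psi\in\Psi\},\qquad FWS(\Psi):=\{\psi_{d^j;0,k}:j\in\mathbb Z,k\in\mathbb Z,\psi\in\Psi\}.$$ These are indexed families (elements counted with multiplicity), and $\frac1{\sqrt{2\pi}}S$ means every element of the family $S$ is multiplied by $\frac1{\sqrt{2\pi}}$. *)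

(* Defs.v *)
From HB Require Import structures.
From mathcomp Require Import all_boot all_order all_algebra.
From mathcomp Require Import all_classical all_reals all_analysis.
From mathcomp Require Import complex.
Set Implicit Arguments.
Unset Strict Implicit.
Unset Printing Implicit Defensive.
Import Order.TTheory GRing.Theory Num.Theory numFieldNormedType.Exports.
Import Normc.
Local Open Scope classical_set_scope.
Local Open Scope ring_scope.
Local Open Scope complex_scope.

(* The measure theory library has no complex-valued functions: measurability
   and integration of f : R -> R[i] are taken on real and imaginary parts.
   Measurability is Borel, as everywhere in that library; every class of
   Lebesgue measurable functions modulo equality a.e. has a Borel member. *)
Definition cmeasurable (R : realType) (f : R -> R[i]) : Prop :=
  measurable_fun [set: R] (fun x => complex.Re (f x)) /\
  measurable_fun [set: R] (fun x => complex.Im (f x)).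

Definition cintegral (R : realType) (f : R -> R[i]) : R[i] :=
  (\int[lebesgue_measure]_x complex.Re (f x))
  +i* (\int[lebesgue_measure]_x complex.Im (f x)).

Definition L2norm (R : realType) (f : R -> R[i]) : \bar R :=
  'N[lebesgue_measure]_2%:E [EFin \o (@normc R \o f)].

Definition in_L2R (R : realType) (f : R -> R[i]) : Prop :=
  cmeasurable f /\ (L2norm f < +oo)%E.

Definition in_L2T (R : realType) (h : R -> R[i]) : Prop :=
  [/\ periodic h (pi *+ 2),
      cmeasurable h &
      (\int[lebesgue_measure]_(x in `[(- pi)%R, pi%R]) (normc (h x) ^+ 2)%:E
        < +oo)%E].

Definition inner (R : realType) (f g : R -> R[i]) : R[i] :=
  cintegral (fun x => f x * conjc (g x)).

Definition expi (R : realType) (t : R) : R[i] := cos t +i* sin t.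

(* f_{lambda;0,k} *)
Definition dilmod (R : realType) (lambda : R) (k : int) (f : R -> R[i]) :
    R -> R[i] :=
  fun xi => (Num.sqrt `|lambda|)%:C * expi (- (k%:~R * lambda * xi))
            * f (lambda * xi).

(* Families carry their index type, so that elements are counted with
   multiplicity. *)
Definition FWSJ (R : realType) (d : R) (r s : nat) (J : int)
    (phi : 'I_r -> R -> R[i]) (psi : 'I_s -> R -> R[i])
    (i : ('I_r * int) + ({j : int | J <= j} * 'I_s * int)) : R -> R[i] :=
  match i with
  | inl (l, k) => dilmod (d ^ (- J)) k (phi l)
  | inr (j, l, k) => dilmod (d ^ (- sval j)) k (psi l)
  end.

Arguments FWSJ {R} d {r s} J phi psi i.

Definition FWS (R : realType) (d : R) (s : nat) (psi : 'I_s -> R -> R[i])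
    (i : int * 'I_s * int) : R -> R[i] :=
  let: (j, l, k) := i in dilmod (d ^ j) k (psi l).

Definition normalized (R : realType) (I : Type) (e : I -> R -> R[i]) :
    I -> R -> R[i] :=
  fun i xi => ((Num.sqrt (pi *+ 2))^-1)%:C * e i xi.

Definition orthonormal_family (R : realType) (I : Type)
    (e : I -> R -> R[i]) : Prop :=
  (forall i, inner (e i) (e i) = 1) /\
  (forall i j, i <> j -> inner (e i) (e j) = 0).

(* A finite linear combination is given by the list of its pairs
   (coefficient, index). *)
Definition span_dense_L2R (R : realType) (I : Type)
    (e : I -> R -> R[i]) : Prop :=
  forall f, in_L2R f -> forall eps : R, 0 < eps ->
    exists c : seq (R[i] * I),
      (L2norm (fun x => f x - \sum_(p <- c) p.1 * e p.2 x)%R < eps%:E)%E.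

Definition orthonormal_basis_L2R (R : realType) (I : Type)
    (e : I -> R -> R[i]) : Prop :=
  [/\ forall i, in_L2R (e i), orthonormal_family e & span_dense_L2R e].

Definition FWSJ_parseval (R : realType) (d : R) (r s : nat) (J : int)
    (phi : 'I_r -> R -> R[i]) (psi : 'I_s -> R -> R[i]) : Prop :=
  forall f, in_L2R f ->
    (\sum_(l < r) \esum_(k in [set: int])
        (normc (inner f (dilmod (d ^ (- J))%R k (phi l))) ^+ 2)%:E
     + \esum_(j in [set j : int | (J <= j)%R]) \sum_(l < s)
         \esum_(k in [set: int])
           (normc (inner f (dilmod (d ^ (- j))%R k (psi l))) ^+ 2)%:E
     = (pi *+ 2)%:E * (L2norm f * L2norm f))%E.

Definition colfun (R : realType) (n : nat) (f : 'I_n -> R -> R[i]) (xi : R) :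
    'cV[R[i]]_n :=
  \col_i f i xi.

(* Main.v *)
From HB Require Import structures.
Require Import Defs.
From mathcomp Require Import all_boot all_order all_algebra.
From mathcomp Require Import all_classical all_reals all_analysis measurable_realfun.
From mathcomp Require Import complex ring lra.
Import Order.TTheory GRing.Theory Num.Theory numFieldNormedType.Exports.
Import Normc.
Local Open Scope classical_set_scope.
Local Open Scope ring_scope.
Local Open Scope complex_scope.
Set Implicit Arguments.
Unset Strict Implicit.
Unset Printing Implicit Defensive.

(** The first equivalence is Hilbert space theory: an orthonormal family has dense
    span exactly when it satisfies Parseval's identity ([orthonormal_basisP]), and
    Parseval's identity together with unit norms forces orthogonality, because
    [e i] has already spent its whole energy on the coefficient along itself
    ([orthonormal_of_parseval]).

    Dilations are unitary and dilating by a power of [d] shifts the level [J].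
    Hence the system is an orthonormal basis for every level as soon as it is one
    for some level ([FWSJ_basis_shift]), and everything else is a comparison of
    different levels.

    The functions [phi l (d * x)] and [psi l (d * x)] are multiples of elements of
    the system at level -1, so they are orthogonal to the wavelets of level at
    least 0. Parseval's identity at level 0 then makes them mean square limits of
    finite combinations of integer modulations of the [phi l], that is of sums
    [\sum_(l < r) t l x * phi l x] with trigonometric polynomials [t l]. The
    modulations of the [phi l] and the exponentials on a period are both
    orthogonal families with constant norm, so the coefficients converge in mean
    square on a period along with the combinations ([sq_cutoff_trig]). When the
    convergence is geometrically fast both converge almost everywhere, and the
    limits of the coefficients are the entries of the matrices
    ([periodic_coefficients]).

    For [1 < `|d|], two elements of the homogeneous system lie in a common system
    at a sufficiently low level, which gives orthonormality. For completeness it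
    is enough to see that the scaling part of Parseval's identity at level [- n]
    tends to 0 for functions in a dense class. Take a bounded [f] supported in
    [c <= `|x| <= C] with [0 < c]. Its inner products with the modulations of
    [phi l] dilated by [d ^+ n] are the Fourier coefficients, on an interval of
    bounded length, of [f] times the conjugate of the dilated [phi l]. By Bessel's
    inequality their energy is bounded by a constant times the integral of
    [normc (phi l x) ^+ 2] over [c * `|d| ^+ n <= `|x|]
    ([fine_scale_energy_le]). *)


(** * Square-integrable complex functions *)

Section L2_functions.
Variable R : realType.
Implicit Types (f g h : R -> R[i]) (c z w : R[i]).
Local Notation mu := (@lebesgue_measure R).
Local Notation RE := (@complex.Re R).
Local Notation IM := (@complex.Im R).

Definition sqnorm f : \bar R := \int[mu]_x ((normc (f x)) ^+ 2)%:E.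

Lemma normc_ge0 z : 0 <= normc z.
Proof. by case: z => a b; exact: sqrtr_ge0. Qed.

Lemma normc_sqr z : normc z ^+ 2 = RE z ^+ 2 + IM z ^+ 2.
Proof. by case: z => a b /=; rewrite sqr_sqrtr // addr_ge0 // sqr_ge0. Qed.

Lemma normc_conjc z : normc (conjc z) = normc z.
Proof. by case: z => a b /=; rewrite sqrrN. Qed.

Lemma mulc_conjc z : z * conjc z = (normc z ^+ 2)%:C.
Proof.
rewrite normc_sqr; case: z => a b /=; apply/eqP; rewrite eq_complex /=.
by apply/andP; split; apply/eqP; ring.
Qed.

Lemma cReD z w : RE (z + w) = RE z + RE w. Proof. by case: z; case: w. Qed.
Lemma cImD z w : IM (z + w) = IM z + IM w. Proof. by case: z; case: w. Qed.
Lemma cReM z w : RE (z * w) = RE z * RE w - IM z * IM w.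
Proof. by case: z; case: w. Qed.
Lemma cImM z w : IM (z * w) = RE z * IM w + IM z * RE w.
Proof. by case: z; case: w. Qed.
Lemma cReJ z : RE (conjc z) = RE z. Proof. by case: z. Qed.
Lemma cImJ z : IM (conjc z) = - IM z. Proof. by case: z. Qed.

Lemma complex_eq z w : RE z = RE w -> IM z = IM w -> z = w.
Proof. by case: z; case: w => /= ? ? ? ? -> ->. Qed.

Lemma measurable_normc2 f : cmeasurable f ->
  measurable_fun [set: R] (fun x => normc (f x) ^+ 2).
Proof.
move=> [mr mi]; under eq_fun do rewrite normc_sqr.
by apply: measurable_funD; apply: measurable_funX.
Qed.

Lemma measurable_normc2E f : cmeasurable f ->
  measurable_fun [set: R] (fun x => (normc (f x) ^+ 2)%:E).
Proof. by move=> /measurable_normc2 mf; exact/measurable_EFinP. Qed.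

Lemma sqnorm_ge0 f : (0 <= sqnorm f)%E.
Proof. by apply: integral_ge0 => x _; rewrite lee_fin sqr_ge0. Qed.

Lemma L2norm_ge0 f : (0 <= L2norm f)%E.
Proof. exact: Lnorm_ge0. Qed.

Lemma L2normM f : (L2norm f * L2norm f = sqnorm f)%E.
Proof.
rewrite /L2norm /sqnorm unlock; set I := (\int[_]_x _)%E.
have h2 : 2^-1 + 2^-1 = 1 :> R by field.
rewrite -poweRD ?add_neq0_poweRD_def ?h2 //.
rewrite poweRe1; last by apply: integral_ge0 => x _; exact: poweR_ge0.
apply: eq_integral => x _ /=; rewrite powR_mulrn //.
by rewrite real_normK // num_real.
Qed.

Lemma L2norm_lt f (e : R) : 0 < e ->
  (L2norm f < e%:E)%E = (sqnorm f < (e ^+ 2)%:E)%E.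
Proof.
move=> e0; rewrite -L2normM; move: (L2norm_ge0 f); case: (L2norm f) => [n| |] //=.
  by rewrite lee_fin => n0; rewrite !lte_fin -expr2 ltr_pXn2r // nnegrE ltW.
Qed.

Lemma L2norm_fin f : (L2norm f < +oo)%E = (sqnorm f < +oo)%E.
Proof.
rewrite -L2normM; move: (L2norm_ge0 f).
by case: (L2norm f) => [n| |] // _; rewrite -?EFinM ?ltry ?mulyy.
Qed.

Lemma L2norm_eq f (c : R) : 0 <= c ->
  L2norm f = c%:E <-> sqnorm f = (c ^+ 2)%:E.
Proof.
move=> c0; rewrite -L2normM; move: (L2norm_ge0 f).
case: (L2norm f) => [n| |] //=.
rewrite lee_fin => n0; split=> [[->]|]; first by rewrite expr2.
by rewrite -EFinM -expr2 => -[/eqP]; rewrite eqrXn2 // => /eqP ->.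
Qed.

Lemma in_L2P f : in_L2R f <-> cmeasurable f /\ (sqnorm f < +oo)%E.
Proof. by rewrite /in_L2R L2norm_fin. Qed.

Lemma cmeasurableD f g : cmeasurable f -> cmeasurable g -> cmeasurable (f + g).
Proof.
move=> [? ?] [? ?]; split.
- rewrite (_ : (fun x => _) = (RE \o f) \+ (RE \o g)); first exact: measurable_funD.
  by apply/funext => x; exact: cReD.
- rewrite (_ : (fun x => _) = (IM \o f) \+ (IM \o g)); first exact: measurable_funD.
  by apply/funext => x; exact: cImD.
Qed.

Lemma cmeasurableM f g : cmeasurable f -> cmeasurable g -> cmeasurable (f * g).
Proof.
move=> [? ?] [? ?]; split.
- rewrite (_ : (fun x => _) =
    ((RE \o f) \* (RE \o g)) \- ((IM \o f) \* (IM \o g))).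
    by apply: measurable_funB; exact: measurable_funM.
  by apply/funext => x; exact: cReM.
- rewrite (_ : (fun x => _) =
    ((RE \o f) \* (IM \o g)) \+ ((IM \o f) \* (RE \o g))).
    by apply: measurable_funD; exact: measurable_funM.
  by apply/funext => x; exact: cImM.
Qed.

Lemma cmeasurable_cst c : cmeasurable (cst c).
Proof. by split; exact: measurable_cst. Qed.

Lemma cmeasurableJ f : cmeasurable f -> cmeasurable (fun x => conjc (f x)).
Proof.
move=> [? ?]; split; first by under eq_fun do rewrite cReJ.
by under eq_fun do rewrite cImJ; exact: measurable_funN.
Qed.

Lemma cmeasurableZ c f : cmeasurable f -> cmeasurable (c *: f).
Proof. exact: (cmeasurableM (cmeasurable_cst c)). Qed.

Lemma cmeasurable_indic (A : set R) : measurable A ->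
  cmeasurable (fun x => (\1_A x)%:C : R[i]).
Proof. by move=> mA; split; [exact: measurable_indic|exact: measurable_cst]. Qed.

Lemma cmeasurable_expi (a : R) : cmeasurable (fun x => expi (a * x)).
Proof.
split=> /=; apply: measurableT_comp => //; try exact: mulrl_measurable.
- by apply: continuous_measurable_fun; exact: continuous_cos.
- by apply: continuous_measurable_fun; exact: continuous_sin.
Qed.

Lemma cmeasurable_dil (l : R) f : cmeasurable f -> cmeasurable (fun x => f (l * x)).
Proof.
have ml : measurable_fun [set: R] (fun x : R => l * x) by exact: mulrl_measurable.
by move=> [mr mi]; split; [exact: (measurableT_comp mr ml)|
  exact: (measurableT_comp mi ml)].
Qed.

(** The parallelogram law without its term [normc (z - w) ^+ 2]. *)
Lemma normcD_sqr_le z w : normc (z + w) ^+ 2 <= 2 * normc z ^+ 2 + 2 * normc w ^+ 2.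
Proof.
rewrite !normc_sqr cReD cImD -subr_ge0.
have -> : 2 * (RE z ^+ 2 + IM z ^+ 2) + 2 * (RE w ^+ 2 + IM w ^+ 2) -
  ((RE z + RE w) ^+ 2 + (IM z + IM w) ^+ 2) =
  (RE z - RE w) ^+ 2 + (IM z - IM w) ^+ 2 by ring.
by rewrite addr_ge0 // sqr_ge0.
Qed.

(** This replaces the triangle inequality wherever only smallness matters: the
    factor 2 spares all square roots. *)
Lemma sqnormD_le f g : cmeasurable f -> cmeasurable g ->
  (sqnorm (f + g)%R <= 2%:E * sqnorm f + 2%:E * sqnorm g)%E.
Proof.
move=> mf mg; rewrite /sqnorm -!ge0_integralZl //=; last 4 first.
- exact: measurable_normc2E.
- by move=> x _; rewrite lee_fin sqr_ge0.
- exact: measurable_normc2E.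
- by move=> x _; rewrite lee_fin sqr_ge0.
rewrite -ge0_integralD //=; last 4 first.
- by move=> x _; rewrite -EFinM lee_fin mulr_ge0 // sqr_ge0.
- by apply/measurable_EFinP; apply: measurable_funM => //; exact: measurable_normc2.
- by move=> x _; rewrite -EFinM lee_fin mulr_ge0 // sqr_ge0.
- by apply/measurable_EFinP; apply: measurable_funM => //; exact: measurable_normc2.
apply: ge0_le_integral => //=.
- by move=> x _; rewrite lee_fin sqr_ge0.
- by apply: measurable_normc2E; exact: cmeasurableD.
- apply/measurable_EFinP; apply: measurable_funD; apply: measurable_funM => //;
  exact: measurable_normc2.
- by move=> x _; rewrite -!EFinM -EFinD lee_fin; exact: normcD_sqr_le.
Qed.

Lemma sqnormZ c f : cmeasurable f ->
  sqnorm (c *: f) = ((normc c ^+ 2)%:E * sqnorm f)%E.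
Proof.
move=> mf; rewrite /sqnorm -ge0_integralZl //=; last 3 first.
- exact: measurable_normc2E.
- by move=> x _; rewrite lee_fin sqr_ge0.
- by rewrite lee_fin sqr_ge0.
by apply: eq_integral => x _; rewrite normcM exprMn EFinM.
Qed.

Lemma in_L2D f g : in_L2R f -> in_L2R g -> in_L2R (f + g).
Proof.
move=> /in_L2P[mf nf] /in_L2P[mg ng]; apply/in_L2P; split; first exact: cmeasurableD.
by apply: le_lt_trans (sqnormD_le mf mg) _; rewrite lte_add_pinfty // lte_mul_pinfty.
Qed.

Lemma in_L2Z c f : in_L2R f -> in_L2R (c *: f).
Proof.
move=> /in_L2P[mf nf]; apply/in_L2P; split; first exact: cmeasurableZ.
by rewrite sqnormZ // lte_mul_pinfty // lee_fin sqr_ge0.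
Qed.

Lemma in_L2_0 : in_L2R (0 : R -> R[i]).
Proof.
apply/in_L2P; split; first exact: cmeasurable_cst.
rewrite /sqnorm integral0_eq // => x _; rewrite normc_sqr /=.
by rewrite expr0n /= addr0.
Qed.

Lemma in_L2N f : in_L2R f -> in_L2R (- f).
Proof. by rewrite -scaleN1r; exact: in_L2Z. Qed.

Lemma in_L2B f g : in_L2R f -> in_L2R g -> in_L2R (f - g).
Proof. by move=> hf hg; apply: in_L2D => //; exact: in_L2N. Qed.

Lemma in_L2_sum (I : Type) (s : seq I) (F : I -> R -> R[i]) :
  (forall i, in_L2R (F i)) -> in_L2R (\sum_(i <- s) F i).
Proof.
move=> hF; elim/big_rec : _ => [|i g _ hg]; first exact: in_L2_0.
exact: in_L2D.
Qed.

Lemma in_L2M f g (B : R) : cmeasurable g -> (forall x, normc (g x) <= B) ->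
  in_L2R f -> in_L2R (g * f).
Proof.
move=> mg gB /in_L2P[mf nf]; apply/in_L2P; split; first exact: cmeasurableM.
have B0 : 0 <= B by apply: le_trans (gB 0); exact: normc_ge0.
apply: (@le_lt_trans _ _ ((B ^+ 2)%:E * sqnorm f)%E); last first.
  by rewrite lte_mul_pinfty // lee_fin sqr_ge0.
rewrite /sqnorm -ge0_integralZl //=; last 3 first.
- exact: measurable_normc2E.
- by move=> x _; rewrite lee_fin sqr_ge0.
- by rewrite lee_fin sqr_ge0.
apply: ge0_le_integral => //=.
- by move=> x _; rewrite lee_fin sqr_ge0.
- by apply: measurable_normc2E; exact: cmeasurableM.
- apply/measurable_EFinP; apply: measurable_funM => //;
  exact: measurable_normc2.
- move=> x _; rewrite -EFinM lee_fin normcM exprMn ler_wpM2r ?sqr_ge0 //.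
  by rewrite lerXn2r // nnegrE normc_ge0.
Qed.

End L2_functions.

(** * The inner product *)

Section inner_product.
Variable R : realType.
Implicit Types (f g h : R -> R[i]) (c z w : R[i]).
Local Notation mu := (@lebesgue_measure R).
Local Notation RE := (@complex.Re R).
Local Notation IM := (@complex.Im R).

Lemma conjcD z w : conjc (z + w) = conjc z + conjc w.
Proof. exact: rmorphD. Qed.

Lemma conjcM z w : conjc (z * w) = conjc z * conjc w.
Proof. exact: rmorphM. Qed.

Lemma real_complexD (a b : R) : (a + b)%:C = a%:C + b%:C :> R[i].
Proof. exact: rmorphD. Qed.

Lemma normr_cRe z : `|RE z| <= normc z.
Proof.
rewrite -(@ler_pXn2r _ 2) ?nnegrE ?normc_ge0 // real_normK ?num_real //.
by rewrite normc_sqr lerDl sqr_ge0.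
Qed.

Lemma normr_cIm z : `|IM z| <= normc z.
Proof.
rewrite -(@ler_pXn2r _ 2) ?nnegrE ?normc_ge0 // real_normK ?num_real //.
by rewrite normc_sqr lerDr sqr_ge0.
Qed.

Lemma normcM_le z w : normc (z * w) <= normc z ^+ 2 + normc w ^+ 2.
Proof.
rewrite normcM; have := sqr_ge0 (normc z - normc w).
have := mulr_ge0 (normc_ge0 z) (normc_ge0 w); nra.
Qed.

Lemma integrable_sqnorm f : in_L2R f ->
  mu.-integrable [set: R] (fun x => (normc (f x) ^+ 2)%:E).
Proof.
move=> /in_L2P[mf nf]; apply/integrableP; split; first exact: measurable_normc2E.
rewrite (_ : (\int[_]_x _)%E = sqnorm f) //; apply: eq_integral => x _.
by rewrite gee0_abs // lee_fin sqr_ge0.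
Qed.

(** Since [ab <= a ^+ 2 + b ^+ 2], a product of two square-integrable functions is
    integrable. *)
Lemma integrable_dominated_sqnorm f g (u : R -> R) : in_L2R f -> in_L2R g ->
  measurable_fun [set: R] u -> (forall x, `|u x| <= normc (f x * g x)) ->
  mu.-integrable [set: R] (EFin \o u).
Proof.
move=> hf hg m b.
apply: (le_integrable _ _ _ (integrableD measurableT (integrable_sqnorm hf)
   (integrable_sqnorm hg))) => //; first exact/measurable_EFinP.
move=> x _ /=; rewrite lee_fin (le_trans (b x)) // (le_trans (normcM_le _ _)) //.
exact: ler_norm.
Qed.

Lemma integrable_ReM f g : in_L2R f -> in_L2R g ->
  mu.-integrable [set: R] (EFin \o (fun x => RE (f x * g x))).
Proof.
move=> hf hg; apply: (integrable_dominated_sqnorm hf hg) => [|x].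
  by have [] := cmeasurableM (proj1 hf) (proj1 hg).
exact: normr_cRe.
Qed.

Lemma integrable_ImM f g : in_L2R f -> in_L2R g ->
  mu.-integrable [set: R] (EFin \o (fun x => IM (f x * g x))).
Proof.
move=> hf hg; apply: (integrable_dominated_sqnorm hf hg) => [|x].
  by have [] := cmeasurableM (proj1 hf) (proj1 hg).
exact: normr_cIm.
Qed.

Lemma in_L2J f : in_L2R f -> in_L2R (fun x => conjc (f x)).
Proof.
move=> /in_L2P[mf nf]; apply/in_L2P; split; first exact: cmeasurableJ.
rewrite (_ : sqnorm _ = sqnorm f) //.
by apply: eq_integral => x _; rewrite normc_conjc.
Qed.

Lemma innerDl f g h : in_L2R f -> in_L2R g -> in_L2R h ->
  inner (f + g) h = inner f h + inner g h.
Proof.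
move=> hf hg /in_L2J hh; apply: complex_eq => /=.
- rewrite -RintegralD //; [|exact: integrable_ReM|exact: integrable_ReM].
  by apply: eq_Rintegral => x _; rewrite -cReD -mulrDl.
- rewrite -RintegralD //; [|exact: integrable_ImM|exact: integrable_ImM].
  by apply: eq_Rintegral => x _; rewrite -cImD -mulrDl.
Qed.

Lemma innerZl c f h : in_L2R f -> in_L2R h -> inner (c *: f) h = c * inner f h.
Proof.
move=> hf /in_L2J hh.
have ir := integrable_ReM hf hh; have ii := integrable_ImM hf hh.
have irZ := integrableZl measurableT _ ir; have iiZ := integrableZl measurableT _ ii.
apply: complex_eq; [rewrite [RHS]cReM|rewrite [RHS]cImM]; rewrite /= -!RintegralZl //.
- rewrite -RintegralB //; [|exact: irZ|exact: iiZ].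
  by apply: eq_Rintegral => x _; rewrite -cReM mulrA.
- rewrite -RintegralD //; [|exact: iiZ|exact: irZ].
  by apply: eq_Rintegral => x _; rewrite -cImM mulrA.
Qed.

Lemma innerC f g : in_L2R f -> in_L2R g -> inner g f = conjc (inner f g).
Proof.
move=> hf /in_L2J hg.
have E x : g x * conjc (f x) = conjc (f x * conjc (g x)).
  by rewrite rmorphM /= conjcK mulrC.
apply: complex_eq; rewrite ?cReJ ?cImJ /=.
- by apply: eq_Rintegral => x _; rewrite E cReJ.
- rewrite -mulN1r -RintegralZl //; last exact: (integrable_ImM hf hg).
  by apply: eq_Rintegral => x _; rewrite E cImJ mulN1r.
Qed.

Lemma sqnorm_fin_num f : in_L2R f -> sqnorm f \is a fin_num.
Proof. by move=> /in_L2P[_ nf]; rewrite ge0_fin_numE // sqnorm_ge0. Qed.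

(** The squared norm as a real number, for computing with inner products; it is
    meaningful only for square-integrable functions. *)
Definition sq f : R := fine (sqnorm f).

Lemma sqE f : in_L2R f -> (sq f)%:E = sqnorm f.
Proof. by move=> hf; rewrite /sq fineK // sqnorm_fin_num. Qed.

Lemma sq_ge0 f : 0 <= sq f.
Proof. by rewrite /sq fine_ge0 // sqnorm_ge0. Qed.

Lemma inner_self f : inner f f = (sq f)%:C.
Proof.
apply: complex_eq => /=.
- by rewrite /Rintegral; congr fine; apply: eq_integral => x _; rewrite mulc_conjc.
- rewrite /Rintegral integral0_eq // => x _.
  by rewrite mulc_conjc.
Qed.

Lemma sqZ c f : in_L2R f -> sq (c *: f) = normc c ^+ 2 * sq f.
Proof. by move=> hf; have [mf _] := hf; rewrite /sq sqnormZ // fineM // sqnorm_fin_num.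
Qed.

Lemma sqN f : sq (- f) = sq f.
Proof.
by rewrite /sq /sqnorm; congr fine; apply: eq_integral => x _; rewrite normcN.
Qed.

Lemma sqD_le f g : in_L2R f -> in_L2R g -> sq (f + g) <= 2 * sq f + 2 * sq g.
Proof.
move=> hf hg; rewrite -lee_fin sqE ?EFinD ?EFinM ?sqE //; last exact: in_L2D.
by apply: sqnormD_le; [exact: (proj1 hf)|exact: (proj1 hg)].
Qed.

Lemma innerDr f g h : in_L2R f -> in_L2R g -> in_L2R h ->
  inner h (f + g) = inner h f + inner h g.
Proof.
move=> hf hg hh; rewrite innerC ?innerDl //; last exact: in_L2D.
by rewrite conjcD -!innerC.
Qed.

Lemma innerZr c f h : in_L2R f -> in_L2R h -> inner h (c *: f) = conjc c * inner h f.
Proof.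
move=> hf hh; rewrite innerC ?innerZl //; last exact: in_L2Z.
by rewrite conjcM -innerC.
Qed.

Lemma inner0l h : inner (0 : R -> R[i]) h = 0.
Proof.
by apply: complex_eq => /=; rewrite /Rintegral integral0_eq // => x _;
  rewrite mul0r.
Qed.

Lemma inner_suml (I : Type) (s : seq I) (F : I -> R -> R[i]) h :
  (forall i, in_L2R (F i)) -> in_L2R h ->
  inner (\sum_(i <- s) F i) h = \sum_(i <- s) inner (F i) h.
Proof.
move=> hF hh; elim: s => [|i s IH]; first by rewrite !big_nil inner0l.
by rewrite !big_cons innerDl ?IH //; exact: in_L2_sum.
Qed.

Lemma inner_sumr (I : Type) (s : seq I) (F : I -> R -> R[i]) h :
  (forall i, in_L2R (F i)) -> in_L2R h ->
  inner h (\sum_(i <- s) F i) = \sum_(i <- s) inner h (F i).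
Proof.
move=> hF hh; rewrite innerC ?inner_suml //; last exact: in_L2_sum.
rewrite (big_morph _ conjcD (conjc0 R)).
by apply: eq_bigr => i _; rewrite -innerC.
Qed.

Lemma pythagoras f g : in_L2R f -> in_L2R g -> inner f g = 0 ->
  sq (f + g) = sq f + sq g.
Proof.
move=> hf hg fg.
have E : (sq (f + g))%:C = (sq f + sq g)%:C :> R[i].
  rewrite real_complexD -!inner_self innerDl ?innerDr //; try exact: in_L2D.
  by rewrite fg (innerC hf hg) fg conjc0 add0r addr0.
by case: E.
Qed.

End inner_product.

Arguments inner : simpl never.
Arguments normc : simpl never.

(** * Orthonormal families and Parseval's identity *)

Section families.
Variables (R : realType) (I : choiceType) (e : I -> R -> R[i]).
Hypothesis eL2 : forall i, in_L2R (e i).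
Implicit Types (f g : R -> R[i]) (s : seq I) (c : seq (R[i] * I)).

Definition lincomb c := \sum_(p <- c) p.1 *: e p.2.

Lemma in_L2_lincomb c : in_L2R (lincomb c).
Proof. by apply: in_L2_sum => p; exact: in_L2Z. Qed.

Lemma inner_lincomb f c : in_L2R f ->
  inner f (lincomb c) = \sum_(p <- c) conjc p.1 * inner f (e p.2).
Proof.
move=> hf; rewrite inner_sumr //; last by move=> p; exact: in_L2Z.
by apply: eq_bigr => p _; rewrite innerZr.
Qed.

Lemma inner_lincomb_eq0 f c : in_L2R f ->
  (forall p, p \in c -> inner f (e p.2) = 0) -> inner f (lincomb c) = 0.
Proof.
move=> hf h; rewrite inner_lincomb // big_seq big1 // => p pc.
by rewrite h // mulr0.
Qed.

Lemma lincomb_cat c c' : lincomb (c ++ c') = lincomb c + lincomb c'.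
Proof. exact: big_cat. Qed.

Definition scalecomb (z : R[i]) c := [seq (z * p.1, p.2) | p <- c].

Lemma lincombZ z c : lincomb (scalecomb z c) = z *: lincomb c.
Proof.
by rewrite /lincomb big_map scaler_sumr; apply: eq_bigr => p _; rewrite scalerA.
Qed.

(** Density is tested on squared norms, so that Pythagoras applies to it. *)
Lemma span_denseP : span_dense_L2R e <->
  forall f, in_L2R f -> forall eps : R, 0 < eps ->
    exists c, sq (f - lincomb c) < eps.
Proof.
have E f c : (fun x => f x - \sum_(p <- c) p.1 * e p.2 x) = f - lincomb c.
  by apply/funext => x; rewrite /lincomb [in RHS]/GRing.add /= fct_sumE.
split => h f hf eps e0.
- have e0' : 0 < Num.sqrt eps by rewrite sqrtr_gt0.
  have [c hc] := h f hf _ e0'; exists c; move: hc.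
  rewrite E L2norm_lt // sqr_sqrtr ?ltW // -sqE ?lte_fin //.
  by apply: in_L2B => //; exact: in_L2_lincomb.
- have [c hc] := h f hf (eps ^+ 2) (exprn_gt0 _ e0); exists c.
  rewrite E L2norm_lt // -sqE ?lte_fin //.
  by apply: in_L2B => //; exact: in_L2_lincomb.
Qed.

Lemma sq_lincomb_gram c : (sq (lincomb c))%:C =
  \sum_(p <- c) \sum_(q <- c) conjc p.1 * (q.1 * inner (e q.2) (e p.2)).
Proof.
rewrite -inner_self inner_lincomb; last exact: in_L2_lincomb.
apply: eq_bigr => p _; rewrite inner_suml //; last by move=> q; exact: in_L2Z.
by rewrite mulr_sumr; apply: eq_bigr => q _; rewrite innerZl.
Qed.

Hypothesis one : orthonormal_family e.

Definition proj s f := lincomb [seq (inner f (e i), i) | i <- s].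

Lemma in_L2_proj s f : in_L2R (proj s f).
Proof. exact: in_L2_lincomb. Qed.

Lemma inner_proj s f j : uniq s -> j \in s -> inner (proj s f) (e j) = inner f (e j).
Proof.
move=> us js; rewrite /proj inner_suml //; last by move=> p; exact: in_L2Z.
rewrite big_map (bigD1_seq j) //= innerZl // (proj1 one) mulr1 big1 ?addr0 // => i ij.
by rewrite innerZl // (proj2 one) ?mulr0 //; apply/eqP.
Qed.

Lemma inner_sub_proj s f j : in_L2R f -> uniq s -> j \in s ->
  inner (f - proj s f) (e j) = 0.
Proof.
move=> hf us js; rewrite -scaleN1r innerDl // ?innerZl ?inner_proj //.
- by rewrite mulN1r subrr.
- exact: in_L2_proj.
- by apply: in_L2Z; exact: in_L2_proj.
Qed.

(** Combinations over [s] differ from the projection by a vector of the span of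
    [s], to which [f - proj s f] is orthogonal; hence the projection is the best
    approximation. *)
Lemma sq_sub_lincomb s f c : in_L2R f -> uniq s -> (forall p, p \in c -> p.2 \in s) ->
  sq (f - lincomb c) = sq (f - proj s f) + sq (proj s f - lincomb c).
Proof.
move=> hf us cs.
have hd : in_L2R (f - proj s f) by apply: in_L2B => //; exact: in_L2_proj.
have E : proj s f - lincomb c =
    lincomb ([seq (inner f (e i), i) | i <- s] ++ scalecomb (-1) c).
  by rewrite lincomb_cat lincombZ scaleN1r.
rewrite -pythagoras //.
- by congr sq; rewrite addrA subrK.
- by rewrite E; exact: in_L2_lincomb.
rewrite E inner_lincomb_eq0 // => p; rewrite mem_cat => /orP[/mapP[i is_ ->]|].
  by rewrite inner_sub_proj.
by case/mapP => q qc ->; rewrite inner_sub_proj //=; exact: cs.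
Qed.

Lemma sq_proj s f : in_L2R f -> uniq s ->
  sq (proj s f) = \sum_(i <- s) normc (inner f (e i)) ^+ 2.
Proof.
move=> hf us; have E : (sq (proj s f))%:C =
    (\sum_(i <- s) normc (inner f (e i)) ^+ 2)%:C :> R[i].
  rewrite -inner_self [in X in inner _ X]/proj inner_lincomb; last exact: in_L2_proj.
  rewrite big_map (big_morph _ (@real_complexD R) (erefl (0%:C)%C)) big_seq [RHS]big_seq.
  by apply: eq_bigr => i is_ /=; rewrite inner_proj // mulrC mulc_conjc.
by case: E.
Qed.

Lemma sq_sub_proj s f : in_L2R f -> uniq s ->
  sq (f - proj s f) = sq f - \sum_(i <- s) normc (inner f (e i)) ^+ 2.
Proof.
move=> hf us; rewrite -sq_proj //; have := @sq_sub_lincomb s f [::] hf us.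
by rewrite /lincomb big_nil !subr0 => -> //; rewrite addrK.
Qed.

Lemma bessel s f : in_L2R f -> uniq s ->
  \sum_(i <- s) normc (inner f (e i)) ^+ 2 <= sq f.
Proof. by move=> hf us; rewrite -subr_ge0 -sq_sub_proj // sq_ge0. Qed.

End families.

Lemma sq_lincomb_orthonormal (R : realType) (I : choiceType) (e u : I -> R -> R[i])
  (c : seq (R[i] * I)) : (forall i, in_L2R (e i)) -> (forall i, in_L2R (u i)) ->
  orthonormal_family e -> orthonormal_family u -> sq (lincomb e c) = sq (lincomb u c).
Proof.
move=> eL2 uL2 oe ou.
have E : (sq (lincomb e c))%:C = (sq (lincomb u c))%:C :> R[i].
  rewrite (sq_lincomb_gram eL2) (sq_lincomb_gram uL2).
  apply: eq_bigr => p _; apply: eq_bigr => q _; congr (_ * (_ * _)).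
  have [->|/eqP ne] := eqVneq q.2 p.2; first by rewrite (proj1 oe) (proj1 ou).
  by rewrite (proj2 oe) // (proj2 ou).
by case: E.
Qed.

Section parseval.
Variables (R : realType) (I : choiceType) (e : I -> R -> R[i]).
Hypothesis eL2 : forall i, in_L2R (e i).
Implicit Types (f g : R -> R[i]) (s : seq I).

(** Parseval's identity for [e] at [f] reads [energy f = sqnorm f]. *)
Definition energy f : \bar R := \esum_(i in [set: I]) (normc (inner f (e i)) ^+ 2)%:E.

Lemma energy_ge s f : uniq s ->
  ((\sum_(i <- s) normc (inner f (e i)) ^+ 2)%:E <= energy f)%E.
Proof.
move=> us; apply: esum_ge; exists [set` s].
  by split => //; exact: finite_seq.
by rewrite -sumEFin (fsbig_seq _ _ us).
Qed.

Lemma energy_le (M : R) f :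
  (forall s, uniq s -> \sum_(i <- s) normc (inner f (e i)) ^+ 2 <= M) ->
  (energy f <= M%:E)%E.
Proof.
move=> h; apply: ge_ereal_sup => _ [A [fA _] <-].
by rewrite fsbig_finite //= sumEFin lee_fin; apply: h; exact: finmap.fset_uniq.
Qed.

Lemma energy_gt (a : R) f : (a%:E < energy f)%E ->
  exists2 s, uniq s & a < \sum_(i <- s) normc (inner f (e i)) ^+ 2.
Proof.
move=> /ereal_sup_gt[_ [A [fA _] <-]].
rewrite fsbig_finite //= sumEFin lte_fin => h.
by exists (finmap.enum_fset (fset_set A)) => //; exact: finmap.fset_uniq.
Qed.

Lemma parseval_of_span_dense f : orthonormal_family e -> span_dense_L2R e ->
  in_L2R f -> energy f = sqnorm f.
Proof.
move=> one /(span_denseP eL2) dense hf; rewrite -sqE //; apply/eqP; rewrite eq_le.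
apply/andP; split; first by apply: energy_le => s; exact: bessel.
apply/lee_addgt0Pr => eps eps0; have [c hc] := dense f hf eps eps0.
pose s := undup [seq p.2 | p <- c].
have us : uniq s by exact: undup_uniq.
apply: (@le_trans _ _ ((\sum_(i <- s) normc (inner f (e i)) ^+ 2)%:E + eps%:E)%E).
  rewrite -EFinD lee_fin -lerBlDl -(sq_sub_proj eL2 one) //.
  apply: le_trans (ltW hc); rewrite (sq_sub_lincomb eL2 one hf us) ?lerDl ?sq_ge0 //.
  by move=> p pc; rewrite mem_undup; apply: map_f.
by rewrite leeD2r // energy_ge.
Qed.

(** The finite partial sums of the energy measure exactly the defect of the
    corresponding projections. *)
Lemma span_dense_of_parseval : orthonormal_family e ->
  (forall f, in_L2R f -> energy f = sqnorm f) -> span_dense_L2R e.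
Proof.
move=> one h; apply/(span_denseP eL2) => f hf eps eps0.
have /energy_gt[s us hs] : ((sq f - eps)%:E < energy f)%E.
  by rewrite h // -sqE // lte_fin ltrBlDr ltrDl.
by exists [seq (inner f (e i), i) | i <- s]; rewrite (sq_sub_proj eL2 one) // ltrBlDl -ltrBlDr.
Qed.

(** Testing Parseval's identity on [e i] itself, the diagonal term already
    exhausts the energy, so that all the others vanish. *)
Lemma orthonormal_of_parseval : (forall f, in_L2R f -> energy f = sqnorm f) ->
  (forall i, sq (e i) = 1) -> orthonormal_family e.
Proof.
move=> h n1; have e1 i : inner (e i) (e i) = 1 by rewrite inner_self n1.
split => // i j /eqP ij; apply: eq0_normc; apply/eqP; rewrite -sqrf_eq0.
have := @energy_ge [:: i; j] (e i); rewrite /= inE andbT => /(_ ij).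
rewrite h // -sqE // lee_fin big_cons big_seq1 n1 e1 normc1 expr1n gerDl => h0.
by rewrite eq_le h0 sqr_ge0.
Qed.

Lemma orthonormal_basisP : orthonormal_basis_L2R e <->
  (forall f, in_L2R f -> energy f = sqnorm f) /\ (forall i, sq (e i) = 1).
Proof.
split=> [[_ one d]|[h n1]].
  split=> [f hf|i]; first exact: parseval_of_span_dense.
  by have := proj1 one i; rewrite inner_self => -[].
have one := orthonormal_of_parseval h n1.
by split => //; exact: span_dense_of_parseval.
Qed.

(** By Bessel's inequality it is enough to capture the energy of the members of
    a dense class of functions. *)
Lemma span_dense_of_dense_class (D : (R -> R[i]) -> Prop) : orthonormal_family e ->
  (forall f, in_L2R f -> forall eps : R, 0 < eps ->
     exists g, [/\ D g, in_L2R g & sq (f - g) < eps]) ->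
  (forall g, D g -> in_L2R g -> (sqnorm g <= energy g)%E) ->
  span_dense_L2R e.
Proof.
move=> one dD hD; apply/(span_denseP eL2) => f hf eps eps0.
have e4 : 0 < eps / 4 by rewrite divr_gt0.
have [g [Dg hg fg]] := dD f hf _ e4.
have /energy_gt[s us hs] : ((sq g - eps / 4)%:E < energy g)%E.
  by apply: lt_le_trans (hD g Dg hg); rewrite -sqE // lte_fin ltrBlDr ltrDl.
exists [seq (inner g (e i), i) | i <- s].
rewrite -[X in sq X](subrKA g); apply: le_lt_trans (sqD_le _ _) _.
- exact: in_L2B.
- by apply: in_L2B => //; exact: in_L2_lincomb.
rewrite (sq_sub_proj eL2 one hg us); lra.
Qed.

End parseval.

(** * Dilations and modulations *)

Section dilation_measure.
Variable R : realType.
Local Notation mu := (@lebesgue_measure R).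

Let dil_measurable (l : R) : measurable_fun [set: measurableTypeR R]
  ( *%R l : measurableTypeR R -> measurableTypeR R).
Proof. exact: mulrl_measurable. Qed.

(** The right-hand side is a measure in [A], and the two measures agree on
    half-open intervals; a negative [l] exchanges the end points. *)
Lemma lebesgue_measure_dilation (l : R) (A : set R) : l != 0 -> measurable A ->
  mu A = (`|l|%:E * pushforward mu
    ( *%R l : measurableTypeR R -> measurableTypeR R) A)%E.
Proof.
move=> l0 mA; have nl : 0 <= `|l| by [].
have [nu nuE] : exists nu : {measure set (measurableTypeR R) -> \bar R},
    forall B, nu B = (`|l|%:E * pushforward mu
    ( *%R l : measurableTypeR R -> measurableTypeR R) B)%E.
  unshelve eexists (mscale (NngNum nl) (pushforward mu
    ( *%R l : measurableTypeR R -> measurableTypeR R))).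
    exact: dil_measurable.
  by [].
rewrite -nuE; apply: lebesgue_measure_unique => // _ [[a b]] _ <-.
rewrite nuE /pushforward.
have [l_gt0|l_lt0|l00] := ltgtP 0 l; last by rewrite -l00 eqxx in l0.
- rewrite (_ : _ @^-1` _ = `]a / l, b / l]%classic); last first.
    apply/seteqP; split => x /=; rewrite !in_itv /=;
      by rewrite ltr_pdivrMr // ler_pdivlMr // mulrC.
  rewrite !lebesgue_measure_itv /= !lte_fin ltr_pM2r ?invr_gt0 //.
  case: ifP => _; last by rewrite mule0.
  by rewrite -!EFinB -EFinM gtr0_norm //; congr EFin; field.
- rewrite (_ : _ @^-1` _ = `[b / l, a / l[%classic); last first.
    apply/seteqP; split => x /=; rewrite !in_itv /=;
      by rewrite ltr_ndivlMr // ler_ndivrMr // mulrC andbC.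
  rewrite !lebesgue_measure_itv /= !lte_fin ltr_nM2r ?invr_lt0 //.
  case: ifP => _; last by rewrite mule0.
  by rewrite -!EFinB -EFinM ltr0_norm //; congr EFin; field.
Qed.


Lemma ge0_integral_dilation (l : R) (g : R -> \bar R) : l != 0 ->
  measurable_fun [set: R] g -> (forall x, (0 <= g x)%E) ->
  (\int[mu]_x g x = `|l|%:E * \int[mu]_x g (l * x)%R)%E.
Proof.
move=> l0 mg g0; have nl : 0 <= `|l| by [].
rewrite -(@ge0_integral_pushforward _ _ _ _ _ _ (dil_measurable l) mu setT g) //.
rewrite -(ge0_integral_mscale _ measurableT (NngNum nl)) //.
by apply: eq_measure_integral => A mA _; exact: lebesgue_measure_dilation.
Qed.
End dilation_measure.

Section dilation_operator.
Variable R : realType.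
Implicit Types (f g : R -> R[i]) (l t : R) (k : int).
Local Notation RE := (@complex.Re R).
Local Notation IM := (@complex.Im R).

Lemma Re_inner f g : in_L2R f -> in_L2R g ->
  RE (inner f g) = (sq (f + g) - sq f - sq g) / 2.
Proof.
move=> hf hg; have E : (sq (f + g))%:C =
    (sq f)%:C + (sq g)%:C + (inner f g + conjc (inner f g)).
  rewrite -!inner_self innerDl ?innerDr //; try exact: in_L2D.
  by rewrite -innerC //; ring.
by have /(congr1 RE) := E; rewrite !cReD cReJ /= => ->; field.
Qed.

Lemma Im_inner f g : in_L2R f -> in_L2R g ->
  IM (inner f g) = RE (inner f ('i%C *: g)).
Proof.
move=> hf hg; rewrite innerZr // [conjc _]/= cReM /= mul0r sub0r.
by rewrite mulN1r opprK.
Qed.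

(** By polarization the squared norm determines the inner product. *)
Lemma inner_isometry (T : (R -> R[i]) -> R -> R[i]) f g :
  (forall f g, T (f + g) = T f + T g) -> (forall c f, T (c *: f) = c *: T f) ->
  (forall f, in_L2R f -> in_L2R (T f)) -> (forall f, in_L2R f -> sq (T f) = sq f) ->
  in_L2R f -> in_L2R g -> inner (T f) (T g) = inner f g.
Proof.
move=> TD TZ TL Tsq hf hg.
have reE h : in_L2R h -> RE (inner (T f) (T h)) = RE (inner f h).
  move=> hh; rewrite !Re_inner //; try exact: TL.
  by rewrite -TD !Tsq //; exact: in_L2D.
apply: complex_eq; first exact: reE.
rewrite !Im_inner //; try exact: TL.
by rewrite -TZ reE //; exact: in_L2Z.
Qed.

Definition dil l f : R -> R[i] := fun x => (Num.sqrt `|l|)%:C * f (l * x).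
Definition modul k f : R -> R[i] := fun x => expi (- (k%:~R * x)) * f x.

Lemma dilmodE l k f : dilmod l k f = dil l (modul k f).
Proof. by apply/funext => x; rewrite /dil /modul /dilmod !mulrA. Qed.

Lemma dilD l f g : dil l (f + g) = dil l f + dil l g.
Proof. by apply/funext => x; rewrite /dil /= mulrDr. Qed.

Lemma dilZ l c f : dil l (c *: f) = c *: dil l f.
Proof. by apply/funext => x; rewrite /dil /= mulrCA. Qed.

Lemma normc_real t : 0 <= t -> normc (t%:C : R[i]) = t.
Proof. by move=> t0; rewrite /normc /= expr0n addr0 sqrtr_sqr ger0_norm. Qed.

Lemma normc_expi t : normc (expi t) = 1.
Proof. by rewrite /normc /= cos2Dsin2 sqrtr1. Qed.

Lemma expiD (a b : R) : expi (a + b) = expi a * expi b.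
Proof.
by apply: complex_eq; rewrite ?cReM ?cImM /= ?cosD ?sinD //; ring.
Qed.

Lemma expiN t : expi (- t) = conjc (expi t).
Proof. by rewrite /expi cosN sinN. Qed.

Lemma expi0 : expi (0 : R) = 1.
Proof. by rewrite /expi cos0 sin0. Qed.

Lemma cmeasurable_modul k f : cmeasurable f -> cmeasurable (modul k f).
Proof.
move=> mf; apply: (cmeasurableM _ mf).
rewrite (_ : (fun x => _) = (fun x : R => expi (- k%:~R * x))); last first.
  by apply/funext => x; rewrite mulNr.
exact: cmeasurable_expi.
Qed.

Lemma sqnorm_modul k f : sqnorm (modul k f) = sqnorm f.
Proof. by apply: eq_integral => x _; rewrite normcM normc_expi mul1r. Qed.

Lemma in_L2_modul k f : in_L2R f -> in_L2R (modul k f).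
Proof.
move=> /in_L2P[mf nf]; apply/in_L2P; split; last by rewrite sqnorm_modul.
exact: cmeasurable_modul.
Qed.

Lemma sqnorm_dil l f : l != 0 -> cmeasurable f -> sqnorm (dil l f) = sqnorm f.
Proof.
move=> l0 mf; rewrite [RHS](ge0_integral_dilation l0); last 2 first.
- exact: measurable_normc2E.
- by move=> x; rewrite lee_fin sqr_ge0.
rewrite -ge0_integralZl //=; last first.
- by move=> x _; rewrite lee_fin sqr_ge0.
- by apply: (@measurable_normc2E _ (fun x => f (l * x))); exact: cmeasurable_dil.
apply: eq_integral => x _; rewrite normcM normc_real ?sqrtr_ge0 // exprMn.
by rewrite sqr_sqrtr // EFinM.
Qed.

Lemma cmeasurable_dilop l f : cmeasurable f -> cmeasurable (dil l f).
Proof.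
by move=> mf; apply: (cmeasurableM (cmeasurable_cst _)); exact: cmeasurable_dil.
Qed.

Lemma in_L2_dil l f : l != 0 -> in_L2R f -> in_L2R (dil l f).
Proof.
move=> l0 /in_L2P[mf nf]; apply/in_L2P; split; last by rewrite sqnorm_dil.
exact: cmeasurable_dilop.
Qed.

Lemma inner_dil l f g : l != 0 -> in_L2R f -> in_L2R g ->
  inner (dil l f) (dil l g) = inner f g.
Proof.
move=> l0; apply: (@inner_isometry (dil l)).
- exact: dilD.
- exact: dilZ.
- by move=> h; exact: in_L2_dil.
- by move=> h [mh _]; rewrite /sq sqnorm_dil.
Qed.

Lemma real_complexM (a b : R) : (a * b)%:C = a%:C * b%:C :> R[i].
Proof. exact: rmorphM. Qed.

Lemma dil_dil l m f : dil l (dil m f) = dil (m * l) f.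
Proof.
apply/funext => x; rewrite /dil normrM sqrtrM // !mulrA; congr (_ * _).
by rewrite real_complexM mulrC.
Qed.

Lemma dil_dilmod l m k f : dil l (dilmod m k f) = dilmod (m * l) k f.
Proof. by rewrite !dilmodE dil_dil. Qed.

Lemma in_L2_dilmod l k f : l != 0 -> in_L2R f -> in_L2R (dilmod l k f).
Proof.
by move=> l0 hf; rewrite dilmodE; apply: in_L2_dil => //; exact: in_L2_modul.
Qed.

Lemma sqnorm_dilmod l k f : l != 0 -> in_L2R f -> sqnorm (dilmod l k f) = sqnorm f.
Proof.
move=> l0 [mf _]; rewrite dilmodE sqnorm_dil // ?sqnorm_modul //.
exact: cmeasurable_modul.
Qed.

End dilation_operator.

(** * Rearranging unordered sums *)

Section esum_lemmas.
Variable R : realType.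
Local Open Scope ereal_scope.

Lemma esum_sumtype (A B : choiceType) (a : A + B -> \bar R) : (forall i, 0 <= a i) ->
  \esum_(i in [set: A + B]) a i =
  \esum_(i in [set: A]) a (inl i) + \esum_(i in [set: B]) a (inr i).
Proof.
move=> a0; rewrite (esumID (range (@inl A B))) // !setTI; congr (_ + _).
- apply: reindex_esum; split => [x _|x y _ _ []//|x [y _ <-]]; by [exists x|exists y].
- apply: reindex_esum; split => [x _|x y _ _ []//|[x|x] /= h]; first by move=> [y _].
    by case: h; exists x.
  by exists x.
Qed.

Lemma esum_pair (A B : choiceType) (a : A * B -> \bar R) : (forall i, 0 <= a i) ->
  \esum_(i in [set: A * B]) a i =
  \esum_(x in [set: A]) \esum_(y in [set: B]) a (x, y).
Proof.
move=> a0; rewrite esum_esum //; congr esum; last by apply/funext => -[].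
by apply/seteqP; split.
Qed.

Lemma esum_ord n (a : 'I_n -> \bar R) : (forall i, 0 <= a i) ->
  \esum_(i in [set: 'I_n]) a i = \sum_(i < n) a i.
Proof.
move=> a0; rewrite esum_fset //; last exact: finite_finset.
rewrite (_ : [set: 'I_n] = [set` enum 'I_n]); last first.
  by apply/seteqP; split => i //= _; rewrite mem_enum.
by rewrite -fsbig_seq ?enum_uniq // big_enum.
Qed.

Lemma esum_sig (T : choiceType) (P : pred T) (a : T -> \bar R) : (forall i, 0 <= a i) ->
  \esum_(i in [set: {x : T | P x}]) a (sval i) = \esum_(i in [set x | P x]) a i.
Proof.
move=> a0; apply/esym/reindex_esum; split => [[]//|x y _ _|x Px].
  exact: val_inj.
by exists (exist _ x Px).
Qed.

End esum_lemmas.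

(** * The affine systems *)

Section systems.
Variables (R : realType) (d : R) (r s : nat).
Variables (phi : 'I_r -> R -> R[i]) (psi : 'I_s -> R -> R[i]).
Hypothesis d0 : d != 0.
Hypothesis hphi : forall l, in_L2R (phi l).
Hypothesis hpsi : forall l, in_L2R (psi l).
Implicit Types (f g : R -> R[i]) (J : int).

Local Notation kappa := ((Num.sqrt (pi *+ 2))^-1 : R).

Lemma twopi_gt0 : 0 < pi *+ 2 :> R.
Proof. by rewrite mulrn_wgt0 // pi_gt0. Qed.

Lemma kappa_gt0 : 0 < kappa.
Proof. by rewrite invr_gt0 sqrtr_gt0 twopi_gt0. Qed.

Lemma kappa_sqr : (pi *+ 2) * kappa ^+ 2 = 1.
Proof. by rewrite exprVn sqr_sqrtr ?mulfV ?gt_eqF ?ltW ?twopi_gt0. Qed.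

Lemma normalizedE (I : Type) (e : I -> R -> R[i]) i :
  normalized e i = kappa%:C *: e i.
Proof. by []. Qed.

Lemma in_L2_normalized (I : Type) (e : I -> R -> R[i]) i :
  in_L2R (e i) -> in_L2R (normalized e i).
Proof. by rewrite normalizedE; exact: in_L2Z. Qed.

Lemma in_L2_FWSJ J i : in_L2R (FWSJ d J phi psi i).
Proof.
by case: i => [[l k]|[[j l] k]]; apply: in_L2_dilmod => //; exact: expfz_neq0.
Qed.

Lemma in_L2_FWS i : in_L2R (FWS d psi i).
Proof. by case: i => [[j l] k]; apply: in_L2_dilmod => //; exact: expfz_neq0. Qed.

(** The real factor moves from the family to the function, where Parseval's
    identity absorbs it by homogeneity. *)
Lemma energy_normalized (I : choiceType) (e : I -> R -> R[i]) f :
  (forall i, in_L2R (e i)) -> in_L2R f ->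
  energy (normalized e) f = energy e (kappa%:C *: f).
Proof.
move=> eL2 hf; apply: eq_esum => i _; rewrite normalizedE innerZr // innerZl //.
by rewrite conjc_real.
Qed.

Lemma sq_normalized (I : Type) (e : I -> R -> R[i]) i : in_L2R (e i) ->
  sq (normalized e i) = kappa ^+ 2 * sq (e i).
Proof. by move=> h; rewrite normalizedE sqZ // normc_real // ltW // kappa_gt0. Qed.

Lemma energy_FWSJ J f : energy (FWSJ d J phi psi) f =
 (\sum_(l < r) \esum_(k in [set: int])
        (normc (inner f (dilmod (d ^ (- J))%R k (phi l))) ^+ 2)%:E
     + \esum_(j in [set j : int | (J <= j)%R]) \sum_(l < s)
         \esum_(k in [set: int])
           (normc (inner f (dilmod (d ^ (- j))%R k (psi l))) ^+ 2)%:E)%E.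
Proof.
have n0 z : (0%:E <= (normc z ^+ 2)%:E :> \bar R)%E by rewrite lee_fin sqr_ge0.
rewrite /energy esum_sumtype //; congr (_ + _)%E.
  rewrite esum_pair // esum_ord // => l; exact: esum_ge0.
rewrite esum_pair // esum_pair; last by move=> p; exact: esum_ge0.
pose b (j : int) := (\sum_(l < s) \esum_(k in [set: int])
           (normc (inner f (dilmod (d ^ (- j))%R k (psi l))) ^+ 2)%:E)%E.
rewrite -(@esum_sig _ _ (fun j => J <= j) b); last first.
  by move=> j; apply: sume_ge0 => l _; exact: esum_ge0.
by apply: eq_esum => j _; rewrite esum_ord // => l; exact: esum_ge0.
Qed.

Lemma FWSJ_parsevalP J : FWSJ_parseval d J phi psi <->
  forall f, in_L2R f -> energy (normalized (FWSJ d J phi psi)) f = sqnorm f.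
Proof.
have k0 := kappa_gt0; have kC : kappa%:C != 0 :> R[i].
  by apply/eqP => -[] /eqP; rewrite gt_eqF.
have nk : normc (kappa%:C : R[i]) = kappa by rewrite normc_real // ltW.
split=> h f hf.
- rewrite energy_normalized //; last exact: in_L2_FWSJ.
  rewrite energy_FWSJ h; last exact: in_L2Z.
  rewrite L2normM sqnormZ; last by case: hf.
  by rewrite nk muleA -EFinM kappa_sqr mul1e.
- have hg : in_L2R (kappa%:C^-1 *: f) by exact: in_L2Z.
  have := h _ hg; rewrite energy_normalized //; last exact: in_L2_FWSJ.
  rewrite scalerA mulfV // scale1r energy_FWSJ => ->.
  rewrite sqnormZ; last by case: hf.
  rewrite L2normM normcV nk; congr (_ * _)%E; congr EFin.
  by rewrite exprVn; apply: (mulIf (x := kappa ^+ 2));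
    rewrite ?kappa_sqr ?mulVf // expf_neq0 // gt_eqF.
Qed.

Lemma sq_FWSJP J : (forall i, sq (normalized (FWSJ d J phi psi) i) = 1) <->
  (forall l, L2norm (phi l) = (Num.sqrt (pi *+ 2))%:E) /\
  (forall l, L2norm (psi l) = (Num.sqrt (pi *+ 2))%:E).
Proof.
have key f : in_L2R f ->
    L2norm f = (Num.sqrt (pi *+ 2))%:E <-> kappa ^+ 2 * sq f = 1.
  move=> hf; rewrite L2norm_eq ?sqrtr_ge0 // sqr_sqrtr ?ltW ?twopi_gt0 // -sqE //.
  have kk := kappa_sqr; split=> [[->]|h]; first by rewrite mulrC.
  by congr EFin; rewrite -[RHS]mulr1 -h mulrA kk mul1r.
have dn (m : int) : d ^ m != 0 by exact: expfz_neq0.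
split=> [h|[h1 h2] i].
- split=> l; [apply/(key _ (hphi l))|apply/(key _ (hpsi l))].
    have := h (inl (l, 0)); rewrite (sq_normalized (in_L2_FWSJ _)) /=.
    by rewrite /sq sqnorm_dilmod.
  have := h (inr (exist _ J (lexx J), l, 0)); rewrite (sq_normalized (in_L2_FWSJ _)) /=.
  by rewrite /sq sqnorm_dilmod.
- rewrite (sq_normalized (in_L2_FWSJ _)).
  by case: i => [[l k]|[[j l] k]]; rewrite /= /sq sqnorm_dilmod //; apply/key.
Qed.

Lemma FWSJ_basisP J : orthonormal_basis_L2R (normalized (FWSJ d J phi psi)) <->
  [/\ FWSJ_parseval d J phi psi,
      forall l, L2norm (phi l) = (Num.sqrt (pi *+ 2))%:E &
      forall l, L2norm (psi l) = (Num.sqrt (pi *+ 2))%:E].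
Proof.
rewrite orthonormal_basisP; last first.
  by move=> i; apply: in_L2_normalized; exact: in_L2_FWSJ.
rewrite -FWSJ_parsevalP sq_FWSJP; split=> [[? []]|[]] //.
Qed.

(** Dilating by a power of [d] carries the system at level [J] onto the system
    at level [J']. *)
Lemma FWSJ_parseval_shift J J' :
  FWSJ_parseval d J phi psi -> FWSJ_parseval d J' phi psi.
Proof.
move=> h f hf; pose m := J' - J; have dn (z : int) : d ^ z != 0 by exact: expfz_neq0.
have E (j : int) k g : in_L2R g ->
    inner f (dilmod (d ^ (- (j + m))) k g) = inner (dil (d ^ m) f) (dilmod (d ^ (- j)) k g).
  move=> hg; rewrite -(inner_dil (dn m)) //; last exact: in_L2_dilmod.
  by rewrite dil_dilmod -expfzDr // opprD subrK.
have JE : J' = J + m by rewrite /m addrC subrK.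
have nE : (L2norm f * L2norm f = L2norm (dil (d ^ m) f) * L2norm (dil (d ^ m) f))%E.
  by rewrite (L2normM f) (L2normM (dil _ _)) (sqnorm_dil (dn m) (proj1 hf)).
rewrite nE; apply: etrans (h _ (in_L2_dil (dn m) hf)).
apply: (f_equal2 adde).
- apply: eq_bigr => l _; apply: eq_esum => k _.
  by rewrite JE E.
- rewrite (@reindex_esum _ _ _ [set j | J <= j] [set j | J' <= j] (fun j => j + m)).
    apply: eq_esum => j _; apply: eq_bigr => l _; apply: eq_esum => k _.
    by rewrite E.
  split=> [j /= Jj|i j _ _ /addIr //|j /= Jj]; first by rewrite JE lerD2r.
  by exists (j - m); rewrite ?subrK //= lerBrDr -JE.
Qed.

Lemma FWSJ_basis_shift J J' :
  orthonormal_basis_L2R (normalized (FWSJ d J phi psi)) ->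
  orthonormal_basis_L2R (normalized (FWSJ d J' phi psi)).
Proof.
move=> /FWSJ_basisP[h n1 n2]; apply/FWSJ_basisP; split => //.
exact: FWSJ_parseval_shift h.
Qed.

End systems.

(** * Exponentials on symmetric intervals *)

Section exponentials.
Variable R : realType.
Implicit Types (a A l x : R) (k m : int) (f : R -> R[i]).
Local Notation mu := (@lebesgue_measure R).

Lemma expi_int_pi k : expi (k%:~R * (pi *+ 2)) = 1 :> R[i].
Proof.
have natE n : expi (n%:R * (pi *+ 2)) = 1 :> R[i].
  elim: n => [|n IH]; first by rewrite mul0r expi0.
  by rewrite -natr1 mulrDl mul1r expiD IH mul1r /expi cos2pi sin2pi.
case: k => n; first exact: natE.
by rewrite NegzE mulrNz mulNr expiN natE conjc1.
Qed.

Lemma sin_int_pi k : sin (k%:~R * pi) = 0 :> R.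
Proof.
have natE n : sin (n%:R * pi) = 0 :> R.
  elim: n => [|n IH]; first by rewrite mul0r sin0.
  by rewrite -natr1 mulrDl mul1r sinDpi IH oppr0.
case: k => n; first exact: natE.
by rewrite NegzE mulrNz mulNr sinN natE oppr0.
Qed.

Lemma is_derive_scale a x : is_derive x (1 : R) (fun y : R => a * y) a.
Proof.
have h : is_derive x (1 : R) (a \*: (id : R -> R)) (a *: (1 : R)).
  by apply: is_deriveZ; exact: is_derive_id.
by move: h; rewrite [a *: 1]mulr1.
Qed.

Lemma is_derive_sin_scale a x :
  is_derive x (1 : R) (fun y : R => sin (a * y)) (a * cos (a * x)).
Proof. by rewrite mulrC; exact: (is_derive1_comp _ (is_derive_scale a x)). Qed.

Lemma is_derive_cos_scale a x :
  is_derive x (1 : R) (fun y : R => cos (a * y)) (a * - sin (a * x)).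
Proof. by rewrite mulrC; exact: (is_derive1_comp _ (is_derive_scale a x)). Qed.

Lemma FTC2_everywhere (F f : R -> R) (a b : R) : a < b -> continuous f ->
  (forall x, is_derive x 1 F (f x)) ->
  (\int[mu]_(x in `[a, b]) (f x)%:E = (F b - F a)%:E)%E.
Proof.
move=> ab cf dF.
have cF : continuous F.
  by move=> x; apply: differentiable_continuous; apply/derivable1_diffP; case: (dF x).
rewrite (continuous_FTC2 ab (F := F)) //.
- exact: continuous_subspaceT.
- split => [x _||]; first by case: (dF x).
    by apply: cvg_at_right_filter; exact: cF.
  by apply: cvg_at_left_filter; exact: cF.
- by move=> x _; rewrite derive1E; have [_ ->] := dF x.
Qed.

Lemma integral_cos_scale a A : a != 0 -> 0 < A -> sin (a * A) = 0 ->
  (\int[mu]_(x in `[(- A)%R, A]) (cos (a * x)%R)%:E = 0)%E.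
Proof.
move=> a0 A0 sA; have ltA : - A < A by rewrite (lt_trans _ A0) // oppr_lt0.
have dF x : is_derive x (1 : R) (a^-1 \*: (fun y : R => sin (a * y))) (cos (a * x)).
  by have := is_deriveZ a^-1 (is_derive_sin_scale a x); rewrite [a^-1 *: _]mulKf.
have cf : continuous (fun x : R => cos (a * x)).
  move=> x; apply: continuous_comp; last exact: continuous_cos.
  by apply: mulrl_continuous.
rewrite (FTC2_everywhere ltA cf dF) /GRing.scale /=.
by rewrite mulrN sinN sA oppr0 subrr.
Qed.

Lemma integral_sin_scale a A : a != 0 -> 0 < A ->
  (\int[mu]_(x in `[(- A)%R, A]) (sin (a * x)%R)%:E = 0)%E.
Proof.
move=> a0 A0; have ltA : - A < A by rewrite (lt_trans _ A0) // oppr_lt0.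
have dF x : is_derive x (1 : R) (- a^-1 \*: (fun y : R => cos (a * y))) (sin (a * x)).
  have := is_deriveZ (- a^-1) (is_derive_cos_scale a x).
  by rewrite [- a^-1 *: _]mulNr !mulrN opprK mulKf.
have cf : continuous (fun x : R => sin (a * x)).
  move=> x; apply: continuous_comp; last exact: continuous_sin.
  by apply: mulrl_continuous.
rewrite (FTC2_everywhere ltA cf dF) /GRing.scale /=.
by rewrite mulrN cosN subrr.
Qed.


(** The exponentials of frequencies in [l * int], cut off to a symmetric
    interval whose length is a multiple of their common period, where distinct
    ones are orthogonal. *)
Definition wave l (M : nat) k : R -> R[i] := fun x =>
  (\1_(`[- (pi * M%:R / `|l|), pi * M%:R / `|l|]%classic) x)%:C * expi (- (k%:~R * l * x)).

Arguments wave : simpl never.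

Lemma cmeasurable_wave l M k : cmeasurable (wave l M k).
Proof.
apply: cmeasurableM; first by apply: cmeasurable_indic; exact: measurable_itv.
rewrite (_ : (fun x => _) = (fun x : R => expi (- (k%:~R * l) * x))); last first.
  by apply/funext => x; rewrite mulNr.
exact: cmeasurable_expi.
Qed.

Lemma normc_indic (B : set R) x : normc ((\1_B x)%:C : R[i]) = \1_B x.
Proof. by rewrite normc_real. Qed.

Lemma halfperiod_gt0 l M : l != 0 -> 0 < pi * M.+1%:R / `|l|.
Proof. by move=> l0; rewrite divr_gt0 ?normr_gt0 // mulr_gt0 // pi_gt0. Qed.

Lemma integral_indic_mul (B : set R) (g : R -> R) : measurable B ->
  (\int[mu]_x (\1_B x * g x)%R%:E = \int[mu]_(x in B) (g x)%:E)%E.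
Proof.
move=> mB; rewrite [RHS]integral_mkcond; apply: eq_integral => x _.
rewrite patchE indicE; case: ifPn => xB; rewrite ?mul1r ?mul0r //.
Qed.

(** A product of two waves is again a wave, at the difference of the frequencies;
    for distinct ones its integral runs over whole periods and vanishes. *)
Lemma inner_wave l M j k : l != 0 ->
  inner (wave l M.+1 j) (wave l M.+1 k) =
  (if j == k then 2 * (pi * M.+1%:R / `|l|) else 0)%:C.
Proof.
move=> l0; set A := pi * M.+1%:R / `|l|.
have A0 : 0 < A by exact: halfperiod_gt0.
have E x : wave l M.+1 j x * conjc (wave l M.+1 k x) =
    (\1_(`[- A, A]%classic) x)%:C * expi ((k - j)%:~R * l * x).
  rewrite /wave conjcM conjc_real -expiN mulrACA -expiD -real_complexM.
  congr (_%:C * expi _); last by rewrite opprK intrB; ring.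
  by rewrite indicE; case: (_ \in _); rewrite ?mulr1 ?mulr0.
have mI : measurable (`[- A, A]%classic : set R) by exact: measurable_itv.
have -> : inner (wave l M.+1 j) (wave l M.+1 k) =
  (fine (\int[mu]_(x in `[- A, A]) (cos ((k - j)%:~R * l * x))%:E)) +i*
  (fine (\int[mu]_(x in `[- A, A]) (sin ((k - j)%:~R * l * x))%:E)).
  rewrite /inner; have -> : (fun x => wave l M.+1 j x * conjc (wave l M.+1 k x)) =
      (fun x => (\1_(`[- A, A]%classic) x)%:C * expi ((k - j)%:~R * l * x)).
    by apply/funext => x; exact: E.
  rewrite /cintegral /Rintegral; congr (fine _ +i* fine _);
    rewrite -[RHS]integral_indic_mul //; apply: eq_integral => x _ /=.
    by rewrite mul0r subr0.
  by rewrite mul0r addr0.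
case: eqVneq => [->|jk].
  have -> : (fun x : R => (cos ((k - k)%:~R * l * x))%:E) = cst 1%:E.
    by apply/funext => x; rewrite subrr !mul0r cos0.
  have -> : (fun x : R => (sin ((k - k)%:~R * l * x))%:E) = cst 0%:E.
    by apply/funext => x; rewrite subrr !mul0r sin0.
  have mE : lebesgue_measure (`[- A, A]%classic : set R) = (2 * A)%:E.
    rewrite lebesgue_measure_itv /= lte_fin gtrN //.
    by rewrite -EFinB opprK mulr_natl mulr2n.
  rewrite integral_cst // integral0 mul1e; congr (_ +i* _).
  by rewrite -[RHS]/(fine (2 * A)%:E); congr fine; exact: mE.
have a0 : (k - j)%:~R * l != 0 :> R.
  by rewrite mulf_neq0 // intr_eq0 subr_eq0 eq_sym.
rewrite integral_sin_scale // integral_cos_scale //.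
rewrite /A; have -> : (k - j)%:~R * l * (pi * M.+1%:R / `|l|) =
    Num.sg l * (((k - j) * M.+1%:Z)%:~R * pi).
  rewrite intrM {1}[l]numEsg; field; by rewrite normr_eq0.
by rewrite sin_sg sin_int_pi mulr0.
Qed.

Lemma in_L2_wave l M k : l != 0 -> in_L2R (wave l M.+1 k).
Proof.
move=> l0; apply/in_L2P; split; first exact: cmeasurable_wave.
set A := pi * M.+1%:R / `|l|.
have mI : measurable (`[- A, A]%classic : set R) by exact: measurable_itv.
have -> : sqnorm (wave l M.+1 k) = lebesgue_measure (`[- A, A]%classic : set R).
  have := integral_indic mu (measurableT) mI; rewrite setIT => <-.
  apply: eq_integral => x _; rewrite /wave normcM normc_expi mulr1 normc_indic.
  by rewrite indicE; case: (_ \in _); rewrite /= ?expr1n ?expr0n.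
by rewrite lebesgue_measure_itv /=; case: ifP => _ //; rewrite -EFinB ltry.
Qed.

Definition nwave l M k : R -> R[i] :=
  ((Num.sqrt (2 * (pi * M.+1%:R / `|l|)))^-1)%:C *: wave l M.+1 k.

Lemma in_L2_nwave l M k : l != 0 -> in_L2R (nwave l M k).
Proof. by move=> l0; apply: in_L2Z; exact: in_L2_wave. Qed.

Lemma orthonormal_nwave l M : l != 0 -> orthonormal_family (nwave l M).
Proof.
move=> l0; have hw k := @in_L2_wave l M k l0.
have A0 := halfperiod_gt0 M l0.
split=> [k|j k /eqP jk]; rewrite innerZl ?innerZr ?inner_wave //; try exact: in_L2Z.
  rewrite eqxx conjc_real -!real_complexM mulrA -expr2 exprVn sqr_sqrtr.
    by rewrite mulVf // mulf_neq0 // gt_eqF.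
  by rewrite mulr_ge0 // ltW.
by rewrite (negPf jk) !mulr0.
Qed.

End exponentials.

(** * Lebesgue-almost everywhere *)

Section ae.
Variable R : realType.
Local Notation mu := (@lebesgue_measure R).
Implicit Types P Q : R -> Prop.
Definition lae P := \forall x \ae mu, P x.
Let muM : {measure set (measurableTypeR R) -> \bar R} := mu.

(** The filter structure attaches to the bundled measure [muM], whereas [lae] is
    about the bare set function. *)
Lemma laeE P : lae P <-> almost_everywhere muM P.
Proof. by []. Qed.

Let muF : Filter (almost_everywhere muM) := ae_filter_ringOfSetsType muM.

Lemma laeS P Q : (forall x, P x -> Q x) -> lae P -> lae Q.
Proof. by move=> PQ /laeE h; apply/laeE; exact: (@filterS _ _ muF P Q). Qed.

Lemma laeI P Q : lae P -> lae Q -> lae (fun x => P x /\ Q x).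
Proof. by move=> /laeE h /laeE h'; apply/laeE; exact: (@filterI _ _ muF P Q). Qed.

Lemma laeW P : (forall x, P x) -> lae P.
Proof. by move=> h; apply/laeE; exact: aeW. Qed.

Lemma lae_fin (I : finType) (P : I -> R -> Prop) :
  (forall i, lae (P i)) -> lae (fun x => forall i, P i x).
Proof. by move=> h; exact: (@filter_forall _ I P _ muF (fun i => (laeE (P i)).1 (h i))). Qed.

Lemma lae_all (P : nat -> R -> Prop) : (forall n, lae (P n)) -> lae (fun x => forall n, P n x).
Proof. by move=> h; exact: (@ae_foralln _ _ _ muM P (fun n => (laeE (P n)).1 (h n))). Qed.
End ae.


(** * The scaling part vanishes at fine scales *)

Section truncation.
Variable R : realType.
Implicit Types (f g phi : R -> R[i]) (B : set R) (c C l x : R).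
Local Notation mu := (@lebesgue_measure R).

Definition cutoff B f : R -> R[i] := fun x => (\1_B x)%:C * f x.

Lemma in_L2_cutoff B f : measurable B -> in_L2R f -> in_L2R (cutoff B f).
Proof.
move=> mB; apply: (@in_L2M _ _ (fun x => (\1_B x)%:C) 1).
  exact: cmeasurable_indic.
by move=> x; rewrite normc_indic indicE lern1 leq_b1.
Qed.

Lemma sub_cutoff B f : f - cutoff B f = cutoff (~` B) f.
Proof.
apply/funext => x; rewrite -[LHS]/(f x - cutoff B f x) /cutoff !indicE in_setC.
by case: (x \in B); rewrite /= ?mul1r ?mul0r ?subrr ?subr0.
Qed.

(** Dominated convergence, with dominating function [normc (f x) ^+ 2]. *)
Lemma sq_cutoff_cvg0 f (B : nat -> set R) : in_L2R f -> (forall n, measurable (B n)) ->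
  lae (fun x => \forall n \near \oo, ~ B n x) ->
  sq (cutoff (B n) f) @[n --> \oo] --> 0.
Proof.
move=> hf mB aeB; pose f_ n x := (normc (cutoff (B n) f x) ^+ 2)%:E.
have fL n : in_L2R (cutoff (B n) f) by exact: in_L2_cutoff.
have [] := @dominated_convergence _ _ R mu setT measurableT f_ (cst 0%E)
  (fun x => (normc (f x) ^+ 2)%:E).
- by move=> n; apply: measurable_normc2E; case: (fL n).
- exact: measurable_cst.
- have h : lae (fun x => [set: R] x -> f_ ^~ x @ \oo --> 0%E).
    apply: laeS aeB => x xB _; apply: cvg_near_cst.
    apply: filterS xB => n nB; rewrite /f_ /cutoff indicE memNset //.
    by rewrite mul0r normc0 expr0n.
  exact: h.
- exact: integrable_sqnorm.
- apply: aeW => x n _; rewrite gee0_abs ?lee_fin ?sqr_ge0 // normcM exprMn.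
  rewrite normc_indic indicE ler_piMl ?sqr_ge0 // exprn_ile1 //.
  by rewrite lern1 leq_b1.
move=> _ _; rewrite integral0 => h.
by have /fine_cvgP[_] := h; exact.
Qed.

Definition tail_set c : set R := [set x | c <= `|x|].

Lemma measurable_tail_set c : measurable (tail_set c).
Proof.
rewrite (_ : tail_set c = Num.Def.normr @^-1` `[c, +oo[%classic); last first.
  by apply/seteqP; split => x; rewrite /tail_set /= in_itv /= andbT.
by rewrite -[X in measurable X]setTI; apply: (@normr_measurable R setT).
Qed.

Lemma near_expr_gt c l x : 0 < c -> 1 < `|l| ->
  \forall n \near \oo, `|x| < c * `|l ^+ n|.
Proof.
move=> c0 l1; have l0 : 0 < `|l| by apply: lt_trans l1.
have : (fun n => `|x| / c * (`|l|^-1) ^+ n) @ \oo --> (0 : R).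
  by apply: cvg_geometric; rewrite normfV normr_id invf_lt1.
move=> /cvgrPdist_lt /(_ 1 ltr01); apply: filterS => n.
rewrite sub0r normrN ger0_norm; last first.
  by rewrite mulr_ge0 ?divr_ge0 // ?exprn_ge0 ?invr_ge0 // ltW.
by rewrite exprVn ltr_pdivrMr ?exprn_gt0 // mul1r ltr_pdivrMr // mulrC normrX.
Qed.

Lemma sq_cutoff_tail_cvg0 c l phi : 0 < c -> 1 < `|l| -> in_L2R phi ->
  sq (cutoff (tail_set (c * `|l ^+ n|)) phi) @[n --> \oo] --> 0.
Proof.
move=> c0 l1 hphi; apply: sq_cutoff_cvg0 => //.
  by move=> n; exact: measurable_tail_set.
apply: laeW => x; apply: filterS (near_expr_gt x c0 l1) => n h.
by rewrite /tail_set /=; apply/negP; rewrite -ltNge.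
Qed.

(** Vanishing near the origin is what makes the inner products with the finely
    scaled generators small; boundedness and bounded support make them
    estimable by Bessel's inequality. *)
Definition annular f := exists B c C : R, [/\ 0 < c, 0 <= C,
  forall x, normc (f x) <= B & forall x, f x <> 0 -> c <= `|x| <= C].

(** Truncations of [f] in modulus and in support reach every point except the
    origin, which is negligible. *)
Lemma annular_dense f : in_L2R f -> forall eps : R, 0 < eps ->
  exists g, [/\ annular g, in_L2R g & sq (f - g) < eps].
Proof.
move=> hf eps eps0.
pose E n : set R := [set x | normc (f x) ^+ 2 <= n.+1%:R] `&`
  (tail_set (n.+1%:R^-1) `&` [set x | `|x| <= n.+1%:R]).
have mE n : measurable (E n).
  apply: measurableI.
    rewrite (_ : [set x | _] = (fun x => normc (f x) ^+ 2) @^-1` `]-oo, n.+1%:R]%classic).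
      rewrite -[X in measurable X]setTI; apply: measurable_normc2 => //.
      by case: hf.
    by apply/seteqP; split => x; rewrite /= in_itv.
  apply: measurableI; first exact: measurable_tail_set.
  rewrite (_ : [set x | _] = Num.Def.normr @^-1` `]-oo, n.+1%:R]%classic).
    by rewrite -[X in measurable X]setTI; apply: (@normr_measurable R setT).
  by apply/seteqP; split => x; rewrite /= in_itv.
have : sq (cutoff (~` E n) f) @[n --> \oo] --> 0.
  apply: sq_cutoff_cvg0 => //; first by move=> n; exact: measurableC.
  have : lae (fun x : R => x <> 0).
    exists [set 0]; split => //; first exact: lebesgue_measure_set1.
    by move=> x /contrapT.
  apply: laeS => x /eqP x0; near=> n; apply; split.
    by rewrite /= (le_trans (ltW (_ : _ < n%:R))) ?ler_nat //; near: n; exact: nbhs_infty_gtr.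
  split; rewrite /tail_set /=; last first.
    by rewrite (le_trans (ltW (_ : _ < n%:R))) ?ler_nat //; near: n; exact: nbhs_infty_gtr.
  rewrite -[leRHS]invrK lef_pV2 ?posrE ?invr_gt0 ?normr_gt0 //.
  by rewrite (le_trans (ltW (_ : _ < n%:R))) ?ler_nat //; near: n; exact: nbhs_infty_gtr.
move=> /cvgrPdist_lt /(_ _ eps0)[n _ /(_ n (leqnn n))].
rewrite sub0r normrN ger0_norm ?sq_ge0 // -sub_cutoff => hn.
exists (cutoff (E n) f); split => //; last exact: in_L2_cutoff.
(* [n.+2] bounds the square root of [n.+1] *)
exists (n.+2%:R), (n.+1%:R^-1), (n.+1%:R); split => //.
- move=> x; rewrite /cutoff normcM normc_indic indicE.
  have [|_] := boolP (x \in E n); rewrite ?mul0r // mul1r => /set_mem[/= fx _].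
  rewrite -(@ler_pXn2r _ 2) ?nnegrE ?normc_ge0 // (le_trans fx) //.
  by rewrite -natrX ler_nat (leq_trans (leqnSn _)) // expnS expn1 leq_pmulr.
- move=> x; rewrite /cutoff indicE; case: (boolP (x \in E n)); last by rewrite mul0r.
  by move=> /set_mem[_ [/= h1 h2]] _; rewrite h1.
Unshelve. all: by end_near. Qed.

End truncation.

Section fine_scale.
Variable R : realType.
Implicit Types (f g phi : R -> R[i]) (B c C l x : R).
Local Notation mu := (@lebesgue_measure R).

Lemma sq_bounded_mul_le f g B : in_L2R g -> cmeasurable f ->
  (forall x, normc (f x) <= B) ->
  in_L2R (f * g) /\ sq (f * g) <= B ^+ 2 * sq g.
Proof.
move=> hg mf fB; have hfg : in_L2R (f * g) by exact: (in_L2M mf fB).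
split=> //; have B0 : 0 <= B by apply: le_trans (fB 0); exact: normc_ge0.
have mg : measurable_fun [set: R] (fun x => (normc (g x) ^+ 2)%:E).
  by apply: measurable_normc2E; case: hg.
rewrite -lee_fin EFinM !sqE // /sqnorm -ge0_integralZl //=; last 2 first.
- by move=> x _; rewrite lee_fin sqr_ge0.
- by rewrite lee_fin sqr_ge0.
apply: ge0_le_integral => //=.
- by move=> x _; rewrite lee_fin sqr_ge0.
- by apply: measurable_normc2E; case: hfg.
- apply/measurable_EFinP; apply: measurable_funM => //.
  by apply: measurable_normc2; case: hg.
- move=> x _; rewrite -EFinM lee_fin normcM exprMn ler_wpM2r ?sqr_ge0 //.
  by rewrite lerXn2r // nnegrE normc_ge0.
Qed.

(** On the support of [f] the modulations of the dilate of [phi] are exponentials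
    that are orthogonal on a symmetric interval of length at most [2 * (C + pi)]
    containing that support, so that Bessel's inequality applies. *)
Lemma fine_scale_energy_le f phi B c C l : in_L2R f -> in_L2R phi -> 1 <= `|l| ->
  0 <= C -> (forall x, normc (f x) <= B) ->
  (forall x, f x <> 0 -> c <= `|x| <= C) ->
  (energy (fun k => dilmod l k phi) f <=
   (2 * (C + pi) * (B ^+ 2 * sq (cutoff (tail_set (c * `|l|)) phi)))%:E)%E.
Proof.
move=> hf hphi l1 C0 fB fs.
have l_gt0 : 0 < `|l| by apply: lt_le_trans l1.
have l0 : l != 0 by rewrite -normr_gt0.
set T := tail_set _; have mT : measurable T by exact: measurable_tail_set.
have hc : in_L2R (cutoff T phi) by exact: in_L2_cutoff.
pose D := dil l (cutoff T phi); have hD : in_L2R D by exact: in_L2_dil.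
have hDJ := in_L2J hD.
(* [inner f (dilmod l k phi)] is the [k]-th Fourier coefficient of [F] *)
pose F := f * (fun x => conjc (D x)).
have [hF sqF] : in_L2R F /\ sq F <= B ^+ 2 * sq (cutoff T phi).
  have [h1 h2] := @sq_bounded_mul_le f _ B hDJ (proj1 hf) fB; split => //.
  apply: le_trans h2 _; rewrite ler_wpM2l ?sqr_ge0 //.
  have -> : sq (cutoff T phi) = sq D by rewrite /sq sqnorm_dil //; case: hc.
  rewrite le_eqVlt; apply/orP; left; apply/eqP; rewrite /sq; congr fine.
  by apply: eq_integral => x _; rewrite normc_conjc.
(* [M.+1] is the least number of half periods [pi / `|l|] exceeding [C] *)
pose M := Num.truncn (C * `|l| / pi).
have /andP[M1 M2] : M%:R <= C * `|l| / pi < M.+1%:R.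
  by apply: truncn_itv; rewrite divr_ge0 ?mulr_ge0 // pi_ge0.
have pi0 : 0 < pi :> R := pi_gt0 R.
pose A := pi * M.+1%:R / `|l|.
have CA : C <= A by rewrite /A ler_pdivlMr // [leRHS]mulrC -ler_pdivrMr // ltW.
have AC : A <= C + pi.
  rewrite /A ler_pdivrMr // -natr1 mulrDr mulr1 [leRHS]mulrDl lerD //; last first.
    by rewrite ler_peMr // ltW.
  by rewrite mulrC -ler_pdivlMr.
have A0 : 0 < A by exact: halfperiod_gt0.
have E k : inner f (dilmod l k phi) = (Num.sqrt (2 * A))%:C * inner F (nwave l M k).
  have s0 : 0 < Num.sqrt (2 * A) by rewrite sqrtr_gt0 mulr_gt0.
  rewrite innerZr //; last exact: in_L2_wave.
  rewrite conjc_real [RHS]mulrA -real_complexM mulfV ?gt_eqF // mul1r.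
  rewrite /inner; congr cintegral; apply/funext => x.
  have [fx0|fx0] := eqVneq (f x) 0; first by rewrite /F /= -[RHS]/(f x * _ * _) fx0 !mul0r.
  have /andP[cx xC] := fs x (elimN eqP fx0).
  rewrite -[RHS]/(f x * conjc (D x) * _) -mulrA; congr (_ * _).
  have -> : D x = (Num.sqrt `|l|)%:C * phi (l * x).
    rewrite /D /dil /cutoff indicE mem_set ?mul1r //.
    by rewrite /T /tail_set /= normrM mulrC ler_wpM2l.
  have -> : wave l M.+1 k x = expi (- (k%:~R * l * x)).
    rewrite /wave indicE mem_set ?mul1r //= in_itv /= -ler_norml.
    exact: le_trans xC CA.
  by rewrite /dilmod !conjcM; ring.
apply: energy_le => s us.
have E2 k : normc (inner f (dilmod l k phi)) ^+ 2 =
    2 * A * normc (inner F (nwave l M k)) ^+ 2.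
  rewrite E normcM exprMn normc_real ?sqrtr_ge0 // sqr_sqrtr //.
  by rewrite mulr_ge0 // ltW.
rewrite (eq_bigr _ (fun k _ => E2 k)) -mulr_sumr.
apply: ler_pM.
- by rewrite mulr_ge0 // ltW.
- by apply: sumr_ge0 => k _; rewrite sqr_ge0.
- by rewrite ler_wpM2l.
- apply: le_trans sqF; apply: bessel => //; last exact: orthonormal_nwave.
  by move=> k; exact: in_L2_nwave.
Qed.

(** Dilating back by [d ^+ n] turns the condition [c <= `|x|] into
    [c * `|d ^+ n| <= `|x|], which only sees a vanishing tail of [phi]. *)
Lemma fine_scale_energy_small f phi (d : R) : in_L2R f -> in_L2R phi ->
  annular f -> 1 < `|d| -> forall eps : R, 0 < eps ->
  \forall n \near \oo, (energy (fun k => dilmod (d ^+ n) k phi) f <= eps%:E)%E.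
Proof.
move=> hf hphi [B [c [C [c0 C0 fB fs]]]] d1 eps eps0.
pose K := 2 * (C + pi) * B ^+ 2.
have K0 : 0 <= K by rewrite /K mulr_ge0 ?sqr_ge0 // mulr_ge0 // addr_ge0 // pi_ge0.
have /cvgrPdist_lt/(_ (eps / (K + 1))) := sq_cutoff_tail_cvg0 c0 d1 hphi.
have K1 : 0 < K + 1 by rewrite ltr_wpDl.
rewrite divr_gt0 // => /(_ isT); apply: filterS => n.
rewrite sub0r normrN ger0_norm ?sq_ge0 // => h.
have l1 : 1 <= `|d ^+ n| by rewrite normrX exprn_ege1 // ltW.
apply: le_trans (fine_scale_energy_le hf hphi l1 C0 fB fs) _.
rewrite lee_fin mulrA -/K.
apply: (@le_trans _ _ (K * (eps / (K + 1)))); first by rewrite ler_wpM2l // ltW.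
rewrite mulrCA ler_piMr ?ltW // ltr_pdivrMr // mul1r.
by rewrite ltrDl.
Qed.

End fine_scale.

(** * The homogeneous system *)

Section homogeneous_system.
Variables (R : realType) (d : R) (r s : nat).
Variables (phi : 'I_r -> R -> R[i]) (psi : 'I_s -> R -> R[i]).
Hypothesis d0 : d != 0.
Hypothesis hphi : forall l, in_L2R (phi l).
Hypothesis hpsi : forall l, in_L2R (psi l).
Implicit Types (f g : R -> R[i]) (J : int).

Lemma energy_comp_le (I1 I2 : choiceType) (e : I2 -> R -> R[i]) (h : I1 -> I2) f :
  injective h -> (energy (e \o h) f <= energy e f)%E.
Proof.
move=> hi; apply: ge_ereal_sup => _ [A [fA _] <-].
rewrite fsbig_finite //= sumEFin.
rewrite -(big_map h xpredT (fun i => normc (inner f (e i)) ^+ 2)).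
by apply: energy_ge; rewrite (map_inj_uniq hi); exact: finmap.fset_uniq.
Qed.

Hypothesis basis : forall J, orthonormal_basis_L2R (normalized (FWSJ d J phi psi)).

(** Two elements of the homogeneous system are wavelets of one and the same
    level-[J] system as soon as [J] is below both of their scales. *)
Lemma orthonormal_FWS : orthonormal_family (normalized (FWS d psi)).
Proof.
have embed j l k J (Jj : J <= - j) :
    normalized (FWS d psi) (j, l, k) =
    normalized (FWSJ d J phi psi) (inr (exist _ (- j) Jj, l, k)).
  by rewrite /normalized /FWS /FWSJ /= opprK.
split=> [[[j l] k]|[[j l] k] [[j' l'] k'] ne].
  rewrite (embed j l k (- j) (lexx _)).
  by have [_ [h _] _] := basis (- j); exact: h.
pose J := Num.min (- j) (- j').
have h1 : J <= - j by rewrite ge_min lexx.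
have h2 : J <= - j' by rewrite ge_min lexx orbT.
rewrite (embed j l k J h1) (embed j' l' k' J h2).
have [_ [_ h] _] := basis J; apply: h => -[] /eqP.
by rewrite eqr_opp => /eqP jj ll kk; apply: ne; rewrite jj ll kk.
Qed.

(** The level [- n] places the scaling functions at the dilation [d ^+ n]. *)
Lemma energy_scaling_small g : in_L2R g -> annular g -> 1 < `|d| ->
  forall eps : R, 0 < eps -> exists n : nat,
  (\esum_(i in [set: 'I_r * int])
     (normc (inner g (normalized (FWSJ d (- n%:Z) phi psi) (inl i))) ^+ 2)%:E <= eps%:E)%E.
Proof.
move=> hg ag d1 eps eps0; set kappa := (Num.sqrt (pi *+ 2))^-1 : R.
have k0 : 0 < kappa := kappa_gt0 R.
have r0 : 0 < r.+1%:R :> R by [].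
pose g' := kappa%:C *: g; have hg' : in_L2R g' by exact: in_L2Z.
have ag' : annular g'.
  case: ag => B [c [C [c0 C0 gB gs]]]; exists (kappa * B), c, C; split => // x.
    by rewrite -[g' x]/(kappa%:C * g x) normcM (normc_real (ltW k0)) ler_wpM2l // ltW.
  by move=> g'x; apply: gs => gx; apply: g'x; rewrite -[LHS]/(_ * g x) gx mulr0.
have e1 : 0 < eps / r.+1%:R by rewrite divr_gt0.
have near_l (l : 'I_r) := fine_scale_energy_small hg' (hphi l) ag' d1 e1.
have : \forall n \near \oo, forall l : 'I_r,
    (energy (fun k => dilmod (d ^+ n) k (phi l)) g' <= (eps / r.+1%:R)%:E)%E.
  exact: filter_forall.
move=> [n _ /(_ n (leqnn n)) hn]; exists n.
rewrite esum_pair; last by move=> i; rewrite lee_fin sqr_ge0.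
rewrite esum_ord; last by move=> l; apply: esum_ge0 => k _; rewrite lee_fin sqr_ge0.
apply: (@le_trans _ _ (\sum_(l < r) (eps / r.+1%:R)%:E)%E).
  apply: lee_sum => l _; apply: le_trans (hn l).
  rewrite /energy le_eqVlt; apply/orP; left; apply/eqP; apply: eq_esum => k _.
  rewrite normalizedE /FWSJ opprK innerZr ?innerZl //; last first.
    by apply: in_L2_dilmod => //; exact: expfz_neq0.
    by apply: in_L2_dilmod => //; exact: expf_neq0.
  by rewrite conjc_real.
rewrite sumEFin lee_fin sumr_const card_ord -[X in X <= _]mulr_natl mulrCA ler_piMr ?ltW //.
by rewrite ltr_pdivrMr // mul1r ltr_nat.
Qed.

(** In Parseval's identity at level [- n] the scaling part is small, and the
    wavelet part runs over a subfamily of the homogeneous system; so the latter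
    captures the whole energy. *)
Lemma FWS_basis : 1 < `|d| -> orthonormal_basis_L2R (normalized (FWS d psi)).
Proof.
move=> d1; have eL2 i : in_L2R (normalized (FWS d psi) i).
  by apply: in_L2_normalized; exact: in_L2_FWS.
split => //; first exact: orthonormal_FWS.
apply: (@span_dense_of_dense_class R _ (normalized (FWS d psi)) eL2 (@annular R)
  orthonormal_FWS (@annular_dense R)) => g ag hg.
apply/lee_addgt0Pr => eps eps0.
have [n hn] := energy_scaling_small hg ag d1 eps0.
have eJ i : in_L2R (normalized (FWSJ d (- n%:Z) phi psi) i).
  by apply: in_L2_normalized; exact: in_L2_FWSJ.
have [/(_ g hg) <- _] := (orthonormal_basisP eJ).1 (basis _).
rewrite /energy esum_sumtype; last by move=> i; rewrite lee_fin sqr_ge0.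
rewrite addeC; apply: leeD => //.
pose h (i : {j : int | - n%:Z <= j} * 'I_s * int) : int * 'I_s * int :=
  (- sval i.1.1, i.1.2, i.2).
have hi : injective h.
  move=> [[j l] k] [[j' l'] k'] [] /eqP; rewrite eqr_opp => /eqP jj -> ->.
  by congr (_, _, _); exact: val_inj.
apply: le_trans (energy_comp_le (normalized (FWS d psi)) g hi).
rewrite le_eqVlt; apply/orP; left; apply/eqP.
by apply: eq_esum => -[[j l] k] _.
Qed.

End homogeneous_system.

(** * Fast convergence in mean square implies convergence almost everywhere *)

Section fast_convergence.
Variable R : realType.
Implicit Types (f g : R -> R[i]) (u v : nat -> R -> R[i]) (z w : R[i]) (K : R).
Local Notation mu := (@lebesgue_measure R).
Local Notation RE := (@complex.Re R).
Local Notation IM := (@complex.Im R).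

(** The series of the [4 ^+ n * normc (u n x) ^+ 2] has a finite integral, hence a
    finite sum [G x] almost everywhere, and the bound holds with the square root
    of [G x] for [S]. *)
Lemma fast_ae_bound u K : (forall n, in_L2R (u n)) ->
  (forall n, sq (u n) <= K * (8^-1) ^+ n) ->
  lae (fun x => exists S : R, forall n, normc (u n x) <= S * (2^-1) ^+ n).
Proof.
move=> uL2 uK; pose F n x : \bar R := (4 ^+ n * normc (u n x) ^+ 2)%:E.
have F0 n x : (0 <= F n x)%E by rewrite /F lee_fin mulr_ge0 // exprn_ge0 // normc_ge0.
have mF n : measurable_fun [set: R] (F n).
  apply/measurable_EFinP; apply: measurable_funM => //.
  by apply: measurable_normc2; case: (uL2 n).
have intF n : (\int[mu]_x F n x <= (K * (2^-1) ^+ n)%:E)%E.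
  rewrite (_ : (\int[mu]_x F n x)%E =
    (\int[mu]_x ((4 ^+ n)%:E * (normc (u n x) ^+ 2)%:E))%E) //.
  rewrite ge0_integralZl //=; last 2 first.
  - by apply: measurable_normc2E; case: (uL2 n).
  - by move=> x _; rewrite lee_fin sqr_ge0.
  rewrite -/(sqnorm (u n)) -sqE // -EFinM lee_fin.
  apply: (@le_trans _ _ (4 ^+ n * (K * (8^-1) ^+ n))).
    by rewrite ler_wpM2l // exprn_ge0.
  by rewrite mulrCA -exprMn; have -> : 4 / 8 = 2^-1 :> R by field.
pose G x : \bar R := (\sum_(0 <= n <oo) F n x)%E.
have mG : measurable_fun [set: R] G by exact: ge0_emeasurable_sum.
have G0 x : (0 <= G x)%E by apply: nneseries_ge0.
have K0 : 0 <= K.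
  by have := uK 0%N; rewrite expr0 mulr1; apply: le_trans; exact: sq_ge0.
have intG : (\int[mu]_x G x <= (K * 2)%:E)%E.
  rewrite integral_nneseries //; apply: lime_le.
    by apply: is_cvg_nneseries => n _ _; exact: integral_ge0.
  apply: nearW => N; apply: (@le_trans _ _ (\sum_(0 <= n < N) (K * (2^-1) ^+ n)%:E)%E).
    by apply: lee_sum => n _; exact: intF.
  rewrite sumEFin lee_fin -mulr_sumr ler_wpM2l //.
  have -> : \sum_(0 <= n < N) (2^-1) ^+ n = 2 - 2 * (2^-1) ^+ N :> R.
    elim: N => [|N IH]; first by rewrite big_geq // expr0 mulr1 subrr.
    by rewrite big_nat_recr //= IH exprS; field.
  by rewrite gerBl mulr_ge0 // exprn_ge0.
have iG : mu.-integrable [set: R] G.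
  apply/integrableP; split => //; apply: (@le_lt_trans _ _ (\int[mu]_x G x)%E).
    rewrite le_eqVlt; apply/orP; left; apply/eqP; apply: eq_integral => x _.
    by rewrite gee0_abs.
  by apply: le_lt_trans intG _; rewrite ltry.
have aeG : lae (fun x => [set: R] x -> G x \is a fin_num).
  exact: (integrable_ae measurableT iG).
apply: laeS aeG => x /(_ I) Gfin; exists (Num.sqrt (fine (G x))) => n.
have h : 4 ^+ n * normc (u n x) ^+ 2 <= fine (G x).
  rewrite -lee_fin fineK //.
  apply: (@le_trans _ _ (\sum_(0 <= i < n.+1) F i x)%E); last exact: nneseries_lim_ge.
  by rewrite big_nat_recr //= -[leLHS]add0e leeD //; exact: sume_ge0.
rewrite -(@ler_pXn2r _ 2) ?nnegrE ?normc_ge0 //.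
rewrite exprMn sqr_sqrtr ?fine_ge0 // -exprM mulnC exprM.
have -> : (2^-1) ^+ 2 = 4^-1 :> R by field.
by rewrite exprVn ler_pdivlMr ?exprn_gt0 // mulrC.
Qed.

(** Coordinatewise convergence, as measurability and integration of complex
    functions are coordinatewise. *)
Definition ccvg (v : nat -> R[i]) z : Prop :=
  (fun n => RE (v n)) @ \oo --> RE z /\ (fun n => IM (v n)) @ \oo --> IM z.

Lemma ccvg_unique (v : nat -> R[i]) z w : ccvg v z -> ccvg v w -> z = w.
Proof.
move=> [r1 i1] [r2 i2]; apply: complex_eq.
  exact: (cvg_unique _ r1 r2).
exact: (cvg_unique _ i1 i2).
Qed.

Lemma ccvg_mul (v : nat -> R[i]) z w : ccvg v z -> ccvg (fun n => v n * w) (z * w).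
Proof.
move=> [hr hi]; split.
- rewrite cReM; under eq_fun do rewrite cReM.
  by apply: cvgB; apply: cvgMr_tmp.
- rewrite cImM; under eq_fun do rewrite cImM.
  by apply: cvgD; apply: cvgMr_tmp.
Qed.

Lemma ccvg_sum (I : Type) (r : seq I) (v : I -> nat -> R[i]) (z : I -> R[i]) :
  (forall i, ccvg (v i) (z i)) ->
  ccvg (fun n => \sum_(i <- r) v i n) (\sum_(i <- r) z i).
Proof.
move=> h; elim: r => [|i r [IHr IHi]].
  rewrite big_nil; under eq_fun do rewrite big_nil.
  by split; exact: cvg_cst.
rewrite big_cons; under eq_fun do rewrite big_cons.
have [hr hi] := h i; split.
- by rewrite cReD; under eq_fun do rewrite cReD; exact: cvgD.
- by rewrite cImD; under eq_fun do rewrite cImD; exact: cvgD.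
Qed.

Lemma cvg_fast (v : nat -> R) (a S : R) : (forall n, `|v n - a| <= S * (2^-1) ^+ n) ->
  v @ \oo --> a.
Proof.
move=> h; apply/cvgrPdist_lt => e e0.
have : (fun n => S * (2^-1) ^+ n) @ \oo --> (0 : R).
  by apply: cvg_geometric; rewrite ger0_norm // invf_lt1 // ltr1n.
move=> /cvgrPdist_lt /(_ e e0); apply: filterS => n; rewrite sub0r normrN => hn.
by rewrite distrC (le_lt_trans (h n)) // (le_lt_trans (ler_norm _)).
Qed.

Lemma ccvg_fast (v : nat -> R[i]) z (S : R) :
  (forall n, normc (z - v n) <= S * (2^-1) ^+ n) -> ccvg v z.
Proof.
have cN w : RE (- w) = - RE w /\ IM (- w) = - IM w by case: w.
move=> h; split; apply: (@cvg_fast _ _ S) => n; apply: le_trans (h n);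
  rewrite distrC.
- by rewrite -(proj1 (cN _)) -cReD; exact: normr_cRe.
- by rewrite -(proj2 (cN _)) -cImD; exact: normr_cIm.
Qed.

Lemma is_cvg_fast (v : nat -> R) (S : R) :
  (forall n, `|v n.+1 - v n| <= S * (2^-1) ^+ n) -> cvgn v.
Proof.
move=> h; have S0 : 0 <= S by have := h 0%N; rewrite expr0 mulr1; apply: le_trans.
have : cvgn (series (telescope v)).
  apply: normed_cvg; apply: (@series_le_cvg _ _ (geometric S (2^-1))) => //.
  - by move=> n; rewrite /= normr_ge0.
  - by move=> n; rewrite /geometric /= mulr_ge0 // exprn_ge0.
  - by apply: is_cvg_geometric_series; rewrite ger0_norm // invf_lt1 // ltr1n.
move=> /cvg_ex[l hl]; apply/cvg_ex; exists (v 0%N + l).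
have hv : (fun n => v 0%N + series (telescope v) n) @ \oo --> v 0%N + l.
  by apply: cvgD => //; exact: cvg_cst.
rewrite (_ : (fun n => v 0%N + _) = v) // in hv.
by apply/funext => n; rewrite -eq_sum_telescope.
Qed.

Lemma ccvg_normc2 (v : nat -> R[i]) z : ccvg v z ->
  (fun n => normc (v n) ^+ 2) @ \oo --> normc z ^+ 2.
Proof.
move=> [hr hi]; rewrite normc_sqr; under eq_fun do rewrite normc_sqr.
by rewrite !expr2; under eq_fun do rewrite !expr2; apply: cvgD; exact: cvgM.
Qed.

Lemma limn_einf_le (v : nat -> \bar R) (K : \bar R) : (forall n, (v n <= K)%E) ->
  (limn_einf v <= K)%E.
Proof.
move=> h; rewrite limn_einf_lim; apply: lime_le; first exact: is_cvg_einfs.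
apply: nearW => n; apply: le_trans (h n); apply: ereal_inf_lbound.
by exists n => //=.
Qed.

(** Fatou's lemma for the squared moduli. *)
Lemma fatou_sqnorm (u : nat -> R -> R[i]) f K : (forall n, in_L2R (u n)) ->
  cmeasurable f -> lae (fun x => ccvg (u^~ x) (f x)) ->
  (forall n, sq (u n) <= K) -> (sqnorm f <= K%:E)%E.
Proof.
move=> uL2 mf cv uK.
have mu2 n : measurable_fun [set: R] (fun x => (normc (u n x) ^+ 2)%:E).
  by apply: measurable_normc2E; case: (uL2 n).
have -> : sqnorm f =
    (\int[mu]_x limn_einf (fun n => (normc (u n x) ^+ 2)%:E))%E.
  apply: ae_eq_integral => //.
  - exact: measurable_normc2E.
  - apply: measurableT_comp => //; apply: measurable_fun_limn_esup => n.
    by apply: measurableT_comp => //; exact: mu2.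
  - have h : lae (fun x => [set: R] x -> (normc (f x) ^+ 2)%:E =
        limn_einf (fun n => (normc (u n x) ^+ 2)%:E)).
      apply: laeS cv => x /ccvg_normc2 cx _.
      have cE : (fun n => (normc (u n x) ^+ 2)%:E) @ \oo --> (normc (f x) ^+ 2)%:E.
        by apply: cvg_EFin => //; exact: nearW.
      by rewrite (cvg_limn_einf_sup cE).1.
    exact: h.
apply: le_trans (fatou mu measurableT mu2 _) _.
  by move=> n x _; rewrite lee_fin sqr_ge0.
by apply: limn_einf_le => n; rewrite -/(sqnorm (u n)) -sqE // lee_fin.
Qed.

End fast_convergence.

(** * Expansions in integer modulations *)

Section trigonometric_sums.
Variable R : realType.
Implicit Types (f g : R -> R[i]) (c : seq (R[i] * int)) (x : R).
Local Notation mu := (@lebesgue_measure R).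
Local Notation kappa := ((Num.sqrt (pi *+ 2))^-1 : R).

(** The factor [kappa] makes [trig c] the coefficient function of a combination of
    normalized shifts. *)
Definition trig c : R -> R[i] := fun x =>
  kappa%:C * \sum_(q <- c) q.1 * expi (- (q.2%:~R * x)).

(** The integer modulations of [f], as they occur in the systems at level 0. *)
Definition shifts f (k : int) : R -> R[i] := normalized (fun k => dilmod 1 k f) k.

Lemma shiftsE f k x : shifts f k x = kappa%:C * (expi (- (k%:~R * x)) * f x).
Proof. by rewrite /shifts /normalized /dilmod normr1 sqrtr1 !mul1r mulr1. Qed.

Lemma in_L2_shifts f k : in_L2R f -> in_L2R (shifts f k).
Proof.
move=> hf; apply: in_L2_normalized; apply: in_L2_dilmod => //.
Qed.

Lemma lincomb_shiftsE f c x : lincomb (shifts f) c x = trig c x * f x.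
Proof.
rewrite /lincomb fct_sumE /trig mulr_sumr mulr_suml; apply: eq_bigr => q _.
by rewrite -[LHS]/(q.1 * shifts f q.2 x) shiftsE; ring.
Qed.

Lemma trig_periodic c : periodic (trig c) (pi *+ 2).
Proof.
move=> x; rewrite /trig; congr (_ * _); apply: eq_bigr => q _; congr (_ * _).
by rewrite mulrDr opprD expiD -[X in _ * expi X]mulNr -intrN expi_int_pi mulr1.
Qed.

Lemma cmeasurable_trig c : cmeasurable (trig c).
Proof.
apply: (cmeasurableM (cmeasurable_cst _)).
elim: c => [|q c IH].
  rewrite (_ : (fun x => _) = cst 0); first exact: cmeasurable_cst.
  by apply/funext => x; rewrite big_nil.
rewrite (_ : (fun x => _) = (cst q.1 * (fun x => expi (- q.2%:~R * x))) +
  (fun x => \sum_(q <- c) q.1 * expi (- (q.2%:~R * x)))).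
  apply: cmeasurableD => //; apply: cmeasurableM; first exact: cmeasurable_cst.
  exact: cmeasurable_expi.
by apply/funext => x; rewrite big_cons -mulNr.
Qed.

Lemma trig_sub c c' x : trig (c ++ scalecomb (-1) c') x = trig c x - trig c' x.
Proof.
rewrite /trig big_cat /= big_map mulrDr; congr (_ + _); rewrite -mulrN; congr (_ * _).
by rewrite -sumrN; apply: eq_bigr => q _ /=; rewrite mulN1r mulNr.
Qed.

(** The support of the waves with frequencies in [int]; [`|1|] is the dilation
    factor in the definition of [wave]. *)
Definition window (M : nat) : set R :=
  `[- (pi * M.+1%:R / `|1|), pi * M.+1%:R / `|1|]%classic.

Lemma measurable_window M : measurable (window M).
Proof. exact: measurable_itv. Qed.

(** Over a window the exponentials have, up to one common factor, the same Gram
    matrix as the shifts of [f]; the coefficient function of a combination of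
    shifts is therefore controlled in mean square by the combination itself. *)
Lemma sq_cutoff_trig f M c : in_L2R f -> orthonormal_family (shifts f) ->
  in_L2R (cutoff (window M) (trig c)) /\
  sq (cutoff (window M) (trig c)) = M.+1%:R * sq (lincomb (shifts f) c).
Proof.
move=> hf one; have n10 : 1 != 0 :> R := oner_neq0 R.
have hw k : in_L2R (nwave (1 : R) M k) by exact: in_L2_nwave.
have ow := orthonormal_nwave M n10.
have A0 : 0 < 2 * (pi * M.+1%:R / `|1 : R|) by rewrite mulr_gt0 // halfperiod_gt0.
pose b := Num.sqrt (2 * (pi * M.+1%:R / `|1 : R|)).
have b0 : 0 < b by rewrite sqrtr_gt0.
have E : cutoff (window M) (trig c) = (kappa * b)%:C *: lincomb (nwave 1 M) c.
  have bV : b%:C * (b^-1)%:C = 1 :> R[i].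
    by rewrite -real_complexM mulfV // gt_eqF.
  apply/funext => x; rewrite -[RHS]/(_ * lincomb (nwave 1 M) c x) /lincomb fct_sumE.
  rewrite /cutoff /trig !mulr_sumr; apply: eq_bigr => q _.
  have -> : (q.1 *: nwave 1 M q.2) x =
      q.1 * ((b^-1)%:C * ((\1_(window M) x)%:C * expi (- (q.2%:~R * x)))).
    by rewrite -[LHS]/(q.1 * ((b^-1)%:C * wave 1 M.+1 q.2 x)) /wave mulr1.
  rewrite real_complexM -[LHS]mul1r -bV; ring.
have gram : sq (lincomb (nwave 1 M) c) = sq (lincomb (shifts f) c).
  by apply: sq_lincomb_orthonormal => // k; exact: in_L2_shifts.
split; first by rewrite E; apply: in_L2Z; exact: in_L2_lincomb.
rewrite E sqZ; last exact: in_L2_lincomb.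
rewrite gram normc_real; last by rewrite mulr_ge0 // ltW // kappa_gt0.
congr (_ * _); rewrite exprMn sqr_sqrtr ?ltW // normr1 divr1.
have kk : pi * 2 * kappa ^+ 2 = 1 by rewrite -[RHS](kappa_sqr R) mulr_natr.
by transitivity (pi * 2 * kappa ^+ 2 * M.+1%:R); [ring|rewrite kk mul1r].
Qed.

End trigonometric_sums.

(** * Periodic coefficients *)

Section refinement.
Variables (R : realType) (r : nat) (phi : 'I_r -> R -> R[i]).
Hypothesis hphi : forall l, in_L2R (phi l).
Implicit Types (f g : R -> R[i]) (x : R).
Local Notation mu := (@lebesgue_measure R).
Local Notation RE := (@complex.Re R).
Local Notation IM := (@complex.Im R).
Local Notation comb := (seq (R[i] * ('I_r * int))).

Definition all_shifts (i : 'I_r * int) : R -> R[i] := shifts (phi i.1) i.2.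
Hypothesis one : orthonormal_family all_shifts.

Let in_L2_all_shifts i : in_L2R (all_shifts i).
Proof. exact: in_L2_shifts. Qed.

Definition part (l : 'I_r) (c : comb) : seq (R[i] * int) :=
  [seq (p.1, p.2.2) | p <- c & p.2.1 == l].

Lemma part_sub l (c c' : comb) :
  part l (c ++ scalecomb (-1) c') = part l c ++ scalecomb (-1) (part l c').
Proof.
rewrite /part filter_cat map_cat; congr (_ ++ _).
by rewrite /scalecomb filter_map -!map_comp.
Qed.

Lemma lincomb_part l (c : comb) :
  lincomb (shifts (phi l)) (part l c) = lincomb all_shifts [seq p <- c | p.2.1 == l].
Proof.
rewrite /lincomb big_map !big_filter; apply: eq_bigr => p /eqP pl.
by rewrite /all_shifts pl.
Qed.

Lemma lincomb_all_shiftsE (c : comb) x :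
  lincomb all_shifts c x = \sum_(l < r) trig (part l c) x * phi l x.
Proof.
transitivity ((\sum_(l < r) lincomb (shifts (phi l)) (part l c)) x).
  congr (_ x); under eq_bigr do rewrite lincomb_part /lincomb big_filter.
  by rewrite /lincomb (partition_big (fun p => p.2.1) xpredT).
by rewrite fct_sumE; apply: eq_bigr => l _; rewrite lincomb_shiftsE.
Qed.

Lemma one_shifts l : orthonormal_family (shifts (phi l)).
Proof.
split=> [k|j k jk]; first exact: (proj1 one (l, k)).
by apply: (proj2 one (l, j) (l, k)) => -[].
Qed.

(** The parts belonging to different generators are orthogonal. *)
Lemma sq_part_le l (c : comb) :
  sq (lincomb (shifts (phi l)) (part l c)) <= sq (lincomb all_shifts c).
Proof.
rewrite lincomb_part; pose c1 := [seq p <- c | p.2.1 == l]; rewrite -/c1.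
pose c2 := [seq p <- c | p.2.1 != l].
have -> : lincomb all_shifts c = lincomb all_shifts c1 + lincomb all_shifts c2.
  by rewrite /lincomb !big_filter; exact: bigID.
have h c' := in_L2_lincomb in_L2_all_shifts c'.
rewrite pythagoras // ?lerDl ?sq_ge0 //.
apply: inner_lincomb_eq0 => // p; rewrite mem_filter => /andP[pl _].
rewrite innerC // inner_lincomb_eq0 ?conjc0 // => q; rewrite mem_filter => /andP[/eqP ql _].
apply: (proj2 one) => pq; move: pl; by rewrite pq ql eqxx.
Qed.

Lemma part_window_le l (c : comb) M :
  in_L2R (cutoff (window M) (trig (part l c))) /\
  sq (cutoff (window M) (trig (part l c))) <= M.+1%:R * sq (lincomb all_shifts c).
Proof.
have [h ->] := sq_cutoff_trig M (part l c) (hphi l) (one_shifts l).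
by split => //; rewrite ler_wpM2l // sq_part_le.
Qed.

Lemma window_cover x : window (Num.truncn `|x|) x.
Proof.
rewrite /window /= in_itv /= -ler_norml normr1 divr1.
have /andP[_ /ltW h] := truncn_itv (normr_ge0 x).
apply: le_trans h _; rewrite ler_peMl //.
by apply: le_trans (pi_ge2 R); rewrite ler1n.
Qed.

(** The upper limit is defined, measurable and periodic without reference to the
    set where the sequence converges. *)
Definition lim_re (v : nat -> R[i]) : R := fine (limn_esup (fun n => (RE (v n))%:E)).
Definition lim_im (v : nat -> R[i]) : R := fine (limn_esup (fun n => (IM (v n))%:E)).

Lemma fine_limn_esup_cvg (v : nat -> R) : cvgn v ->
  v @ \oo --> fine (limn_esup (fun n => (v n)%:E)).
Proof.
move=> /cvg_ex[a va]; have cE : (fun n => (v n)%:E) @ \oo --> a%:E.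
  by apply: cvg_EFin => //; exact: nearW.
by rewrite (cvg_limn_einf_sup cE).2.
Qed.

Lemma measurable_fine_limn_esup (v : nat -> R -> R) :
  (forall n, measurable_fun [set: R] (v n)) ->
  measurable_fun [set: R] (fun x => fine (limn_esup (fun n => (v n x)%:E))).
Proof.
move=> mv; apply: measurableT_comp; first exact: fine_measurable.
by apply: measurable_fun_limn_esup => n; exact/measurable_EFinP.
Qed.

(** Finite combinations [p n] of the shifts converge to [g] geometrically fast in
    mean square. Their coefficient functions [t l n] are trigonometric sums whose
    increments over every window are controlled by the increments of [p n]. So
    both [p n] and all [t l n] converge almost everywhere, and the limits [a l]
    of the coefficients inherit periodicity, and square-integrability over a
    period by Fatou's lemma. *)
Lemma periodic_coefficients g : in_L2R g -> energy all_shifts g = sqnorm g ->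
  exists a : 'I_r -> R -> R[i], (forall l, in_L2T (a l)) /\
    lae (fun x => g x = \sum_(l < r) a l x * phi l x).
Proof.
move=> hg eg.
(* the rate [8^-1] is the one that [fast_ae_bound] asks for *)
have approx n : exists c : comb, sq (g - lincomb all_shifts c) <= (8^-1) ^+ n.
  have e0 : 0 < (8^-1 : R) ^+ n by rewrite exprn_gt0.
  have /energy_gt[s us hs] : ((sq g - (8^-1) ^+ n)%:E < energy all_shifts g)%E.
    by rewrite eg -sqE // lte_fin ltrBlDr ltrDl.
  exists [seq (inner g (all_shifts i), i) | i <- s].
  by rewrite (sq_sub_proj in_L2_all_shifts one) // lerBlDr addrC -lerBlDr ltW.
have [c hc] := choice approx.
pose p n := lincomb all_shifts (c n).
have hp n : in_L2R (p n) by exact: in_L2_lincomb.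
pose delta n := c n.+1 ++ scalecomb (-1) (c n).
have sq_delta n : sq (lincomb all_shifts (delta n)) <= 4 * (8^-1) ^+ n.
  rewrite lincomb_cat lincombZ scaleN1r -/(p n) -/(p n.+1) -(subrKA g).
  apply: le_trans (sqD_le _ _) _; [exact: in_L2B|exact: in_L2B|].
  rewrite -opprB sqN; have := hc n; have := hc n.+1; rewrite -/(p n) -/(p n.+1).
  have : (8^-1 : R) ^+ n.+1 <= (8^-1) ^+ n.
    by rewrite exprS ler_piMl ?exprn_ge0 // invf_le1 // ler1n.
  by nra.
pose t l n := trig (part l (c n)).
pose a l x := (lim_re (t l ^~ x)) +i* (lim_im (t l ^~ x)).
have tE l n x : trig (part l (delta n)) x = t l n.+1 x - t l n x.
  by rewrite part_sub trig_sub.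
have ae_t M l : lae (fun x => exists S : R, forall n,
    normc (cutoff (window M) (trig (part l (delta n))) x) <= S * (2^-1) ^+ n).
  apply: (@fast_ae_bound _ _ (M.+1%:R * 4)) => n.
    by case: (part_window_le l (delta n) M).
  apply: le_trans (proj2 (part_window_le l (delta n) M)) _.
  by rewrite -mulrA ler_wpM2l.
have ae_t' : lae (fun x => forall l M, exists S : R, forall n,
    normc (cutoff (window M) (trig (part l (delta n))) x) <= S * (2^-1) ^+ n).
  by apply: lae_fin => l; apply: lae_all => M; exact: ae_t.
have ae_a : lae (fun x => forall l, ccvg (t l ^~ x) (a l x)).
  apply: laeS ae_t' => x hx l; have [S hS] := hx l (Num.truncn `|x|).
  have hS' n : normc (t l n.+1 x - t l n x) <= S * (2^-1) ^+ n.
    have := hS n; rewrite /cutoff indicE mem_set; last exact: window_cover.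
    by rewrite mul1r tE.
  have cN w : RE (- w) = - RE w /\ IM (- w) = - IM w by case: w.
  split; apply: fine_limn_esup_cvg; apply: (@is_cvg_fast _ _ S) => n;
    apply: le_trans (hS' n).
    by rewrite -(proj1 (cN _)) -cReD; exact: normr_cRe.
  by rewrite -(proj2 (cN _)) -cImD; exact: normr_cIm.
have ae_p : lae (fun x => ccvg (p ^~ x) (g x)).
  have h : lae (fun x => exists S : R, forall n, normc ((g - p n) x) <= S * (2^-1) ^+ n).
    apply: (@fast_ae_bound _ _ 1) => n; first exact: in_L2B.
    by rewrite mul1r; exact: hc.
  by apply: laeS h => x [S hS]; apply: (@ccvg_fast _ _ _ S) => n; exact: hS.
exists a; split; last first.
  apply: laeS (laeI ae_a ae_p) => x [ha hpx].
  apply: (ccvg_unique hpx).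
  have -> : p ^~ x = (fun n => \sum_(l < r) t l n x * phi l x).
    by apply/funext => n; exact: lincomb_all_shiftsE.
  by apply: ccvg_sum => l; exact: ccvg_mul.
move=> l.
have ma : cmeasurable (a l).
  by split; apply: measurable_fine_limn_esup => n; case: (cmeasurable_trig (part l (c n))).
split => //.
- move=> x; rewrite /a; congr (lim_re _ +i* lim_im _); apply/funext => n;
    exact: trig_periodic.
- have hb n := part_window_le l (c n) 0.
  have fin : (sqnorm (cutoff (window 0) (a l)) < +oo)%E.
    apply: (@le_lt_trans _ _ (2 * sq g + 2)%:E); last by rewrite ltry.
    apply: (@fatou_sqnorm _ (fun n => cutoff (window 0) (t l n))).
    + by move=> n; case: (hb n).
    + by apply: cmeasurableM => //; apply: cmeasurable_indic; exact: measurable_window.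
    + apply: laeS ae_a => x /(_ l) h; rewrite /cutoff mulrC.
      by under eq_fun do rewrite mulrC; exact: ccvg_mul.
    + move=> n; apply: le_trans (proj2 (hb n)) _; rewrite mul1r -/(p n).
      have -> : p n = g + - (g - p n) by rewrite opprB addrC subrK.
      apply: le_trans (sqD_le _ _) _ => //; first by apply: in_L2N; exact: in_L2B.
      rewrite sqN lerD2l ler_piMr // (le_trans (hc n)) // exprn_ile1 //.
      by rewrite invf_le1 // ler1n.
  move: fin; rewrite /sqnorm => fin; apply: le_lt_trans fin.
  rewrite [leLHS]integral_mkcond le_eqVlt; apply/orP; left; apply/eqP.
  apply: eq_integral => x _; rewrite patchE /cutoff indicE.
  have -> : window 0 = `[- pi, pi]%classic :> set R.
    by rewrite /window normr1 divr1 mulr1.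
  by case: ifPn => _; rewrite ?mul1r // mul0r normc0 expr0n.
Qed.

End refinement.

(** * Two-scale relations *)

Section two_scale.
Variables (R : realType) (d : R) (r s : nat).
Variables (phi : 'I_r -> R -> R[i]) (psi : 'I_s -> R -> R[i]).
Hypothesis d0 : d != 0.
Hypothesis hphi : forall l, in_L2R (phi l).
Hypothesis hpsi : forall l, in_L2R (psi l).
Hypothesis basis : forall J, orthonormal_basis_L2R (normalized (FWSJ d J phi psi)).
Local Notation kappa := ((Num.sqrt (pi *+ 2))^-1 : R).

Lemma all_shiftsE i : all_shifts phi i = normalized (FWSJ d 0 phi psi) (inl i).
Proof. by case: i => l k; rewrite /all_shifts /shifts /normalized /= oppr0 expr0z. Qed.

(** Up to a constant [f (d * x)] is the dilate of [f] by [d]. If it is orthogonal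
    to the wavelets of the system at level 0, Parseval's identity for that system
    leaves all of its energy to the shifts of the [phi l]. *)
Lemma two_scale_relation f : in_L2R f ->
  (forall i, inner (normalized (dilmod d ^~ f) 0)
    (normalized (FWSJ d 0 phi psi) (inr i)) = 0) ->
  exists a : 'I_r -> R -> R[i], (forall l, in_L2T (a l)) /\
    lae (fun x => f (d * x) = \sum_(l < r) a l x * phi l x).
Proof.
move=> hf orth.
have eL2 i : in_L2R (normalized (FWSJ d 0 phi psi) i).
  by apply: in_L2_normalized; exact: in_L2_FWSJ.
have [_ one _] := basis 0.
have oneS : orthonormal_family (all_shifts phi).
  split=> [i|i j ij]; rewrite !all_shiftsE; first exact: (proj1 one).
  by apply: (proj2 one) => -[].
pose g : R -> R[i] := fun x => f (d * x).
pose b : R := kappa * Num.sqrt `|d|.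
have b0 : 0 < b by rewrite mulr_gt0 ?kappa_gt0 // sqrtr_gt0 normr_gt0.
have bC : b%:C != 0 :> R[i] by apply/eqP => -[] /eqP; rewrite gt_eqF.
have hD : in_L2R (normalized (dilmod d ^~ f) 0).
  by apply: in_L2_normalized; exact: in_L2_dilmod.
have gE : g = (b%:C)^-1 *: normalized (dilmod d ^~ f) 0.
  apply/funext => x; rewrite -[RHS]/(_ * (_ * (_ * _ * _))) mul0r mul0r oppr0 expi0.
  by rewrite mulr1 [kappa%:C * _]mulrA -real_complexM mulrA mulVf // mul1r.
have hg : in_L2R g by rewrite gE; exact: in_L2Z.
apply: (periodic_coefficients hphi oneS hg).
have [/(_ g hg) + _] := (orthonormal_basisP eL2).1 (basis 0).
rewrite {1}/energy esum_sumtype; last by move=> i; rewrite lee_fin sqr_ge0.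
rewrite [X in (_ + X)%E]esum1 ?adde0; last first.
  by move=> i _; rewrite gE innerZl // orth mulr0 normc0 expr0n.
by move=> <-; apply: eq_esum => i _; rewrite all_shiftsE.
Qed.

(** The wavelets at level 0 also belong to the system at level -1, whose other
    elements, among them the dilates by [d] of the generators, are therefore
    orthogonal to them. *)
Let embed (i : {j : int | 0 <= j} * 'I_s * int) :
    {j : int | -1 <= j} * 'I_s * int :=
  (exist _ (sval i.1.1) (le_trans (lerN10 _) (svalP i.1.1)), i.1.2, i.2).

Lemma refinement_phi l : exists a : 'I_r -> R -> R[i], (forall j, in_L2T (a j)) /\
  lae (fun x => phi l (d * x) = \sum_(j < r) a j x * phi j x).
Proof.
apply: two_scale_relation => // -[[j m] k].
have [_ [_ one] _] := basis (-1).
have := one (inl (l, 0)) (inr (embed (j, m, k))).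
by rewrite /normalized /= opprK expr1z; apply.
Qed.

Lemma refinement_psi l : exists a : 'I_r -> R -> R[i], (forall j, in_L2T (a j)) /\
  lae (fun x => psi l (d * x) = \sum_(j < r) a j x * phi j x).
Proof.
apply: two_scale_relation => // -[[j m] k].
have [_ [_ one] _] := basis (-1).
have := one (inr (exist _ (-1) (lexx _), l, 0)) (inr (embed (j, m, k))).
rewrite /normalized /= opprK expr1z; apply => -[] jE _ _.
by have := svalP j; rewrite /= -jE.
Qed.

End two_scale.

Section matrix_form.
Variables (R : realType) (r m : nat) (phi : 'I_r -> R -> R[i]).
Variables (d : R) (f : 'I_m -> R -> R[i]).

Lemma matrix_of_relations :
  (forall i, exists a : 'I_r -> R -> R[i], (forall j, in_L2T (a j)) /\
     lae (fun x => f i (d * x) = \sum_(j < r) a j x * phi j x)) ->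
  exists a : R -> 'M[R[i]]_(m, r), (forall i j, in_L2T (fun x => a x i j)) /\
     lae (fun x => colfun f (d * x) = a x *m colfun phi x).
Proof.
move=> /choice[a ha]; exists (fun x => \matrix_(i, j) a i j x); split.
  move=> i j; rewrite (_ : (fun x => _) = a i j); first by case: (ha i).
  by apply/funext => x; rewrite mxE.
have : lae (fun x => forall i, f i (d * x) = \sum_(j < r) a i j x * phi j x).
  by apply: lae_fin => i; case: (ha i).
apply: laeS => x hx; apply/matrixP => i j; rewrite !mxE hx.
by apply: eq_bigr => k _; rewrite !mxE.
Qed.
End matrix_form.

Theorem proposition11 (R : realType) (d : R) (r s : nat)
    (phi : 'I_r -> R -> R[i]) (psi : 'I_s -> R -> R[i]) (J : int)
    (hd : d != 0)
    (hphi : forall l, in_L2R (phi l)) (hpsi : forall l, in_L2R (psi l)) :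
  (orthonormal_basis_L2R (normalized (FWSJ d J phi psi)) <->
     [/\ FWSJ_parseval d J phi psi,
         forall l, L2norm (phi l) = (Num.sqrt (pi *+ 2))%:E &
         forall l, L2norm (psi l) = (Num.sqrt (pi *+ 2))%:E]) /\
  (orthonormal_basis_L2R (normalized (FWSJ d J phi psi)) ->
     (exists (a : R -> 'M[R[i]]_(r, r)) (b : R -> 'M[R[i]]_(s, r)),
        [/\ forall i j, in_L2T (fun xi => a xi i j),
            forall i j, in_L2T (fun xi => b xi i j) &
            \forall xi \ae @lebesgue_measure R,
              colfun phi (d * xi) = a xi *m colfun phi xi /\
              colfun psi (d * xi) = b xi *m colfun phi xi]) /\
     (1 < `|d| -> orthonormal_basis_L2R (normalized (FWS d psi)))).
Proof.
split; first exact: FWSJ_basisP.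
move=> basisJ.
have basis J' := FWSJ_basis_shift hd hphi hpsi J' basisJ.
split; last exact: (FWS_basis hd hphi hpsi basis).
have [a [aT aE]] := matrix_of_relations (refinement_phi hd hphi hpsi basis).
have [b [bT bE]] := matrix_of_relations (refinement_psi hd hphi hpsi basis).
by exists a, b; split => //; exact: laeI aE bE.
Qed.
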